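(* Let $M\geq 2$ be a prime and let $q$ be a prime power with $(M,q)=1$. Let $t$ be the order of $q$ in $(\mathbb Z/M\mathbb Z)^{\times}$. Then, as formal power series in $u$: (1) $$1+\sum_{n=1}^{\infty}c(n,q,M)_{\mathrm{rg}}\,u^n=c(q,u)\prod_{k=0}^{\infty}c(q^t,u^{M^kt})^{\frac{1-M}{M^{k+1}t}},$$ (2) $$1+\sum_{n=1}^{\infty}c(n,q,M)_{\mathrm{rs}}\,u^n=s(q,u)\prod_{k=0}^{\infty}s(q^t,u^{M^kt})^{\frac{1-M}{M^{k+1}t}}.$$
   Context: $c(q,u)=\dfrac{1-u}{1-qu}$ and $s(q,u)=\dfrac{1-qu^2}{(1+u)(1-qu)}$, viewed as formal power series in $u$ with constant term $1$; $c(q^t,u^{m})$ and $s(q^t,u^m)$ are obtained by substituting $q^t$ for $q$ and $u^m$ for $u$. Rational powers of a power series with constant term $1$ are taken by the binomial series (so they again have constant term $1$). $\mathrm{GL}(n,q)$ is the group of invertible $n\times n$ matrices over the field $\mathbb F_q$ with $q$ elements. Let $\Phi$ be the set of monic irreducible polynomials of degree $\geq 1$ over $\mathbb F_q$ other than $x$. The conjugacy class of $\alpha\in\mathrm{GL}(n,q)$ is determined by its combinatorial data: distinct $f_1,\dots,f_l\in\Phi$ with non-empty partitions $\lambda_{f_i}=(\lambda_{i_1},\lambda_{i_2},\dots)$ satisfying $\sum_i|\lambda_{f_i}|\deg f_i=n$, meaning that the $\mathbb F_q[x]$-module $\mathbb F_q^n$ defined by $\alpha$ is isomorphic to $\bigoplus_{i,j}\mathbb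 F_q[x]/(f_i^{\lambda_{i_j}})$. The element $\alpha$ (and its class) is regular if every $\lambda_{f_i}$ has a single part, and regular semisimple if every $\lambda_{f_i}=(1)$. $c(n,q,M)_{\mathrm{rg}}$ (resp. $c(n,q,M)_{\mathrm{rs}}$) is the number of regular (resp. regular semisimple) conjugacy classes of $\mathrm{GL}(n,q)$ contained in the image of the power map $x\mapsto x^M$ on $\mathrm{GL}(n,q)$. *)

(* Defs.v *)
From HB Require Import structures.
From mathcomp Require Import all_boot all_order all_algebra all_fingroup.
From mathcomp Require Import boolp.

Set Implicit Arguments.
Unset Strict Implicit.
Unset Printing Implicit Defensive.

Import GRing.Theory.
Local Open Scope ring_scope.

(* Formal power series in one variable over a field, with the Cauchy product. *)

Record fps (K : Type) := FPS { fpscoef : nat -> K }.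

HB.instance Definition _ (K : Type) := gen_eqMixin (fps K).
HB.instance Definition _ (K : Type) := gen_choiceMixin (fps K).

Section FpsRing.
Variable K : fieldType.
Implicit Types f g h : fps K.

Lemma fpsP f g : (forall n, fpscoef f n = fpscoef g n) <-> f = g.
Proof.
split=> [|-> //]; case: f g => [f] [g] /= eq_fg.
by congr FPS; apply: functional_extensionality_dep.
Qed.

Definition fps_zero : fps K := FPS (fun=> 0).
Definition fps_opp f : fps K := FPS (fun n => - fpscoef f n).
Definition fps_add f g : fps K := FPS (fun n => fpscoef f n + fpscoef g n).

Fact fps_addA : associative fps_add.
Proof. by move=> f g h; apply/fpsP=> n; apply: addrA. Qed.
Fact fps_addC : commutative fps_add.
Proof. by move=> f g; apply/fpsP=> n; apply: addrC. Qed.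
Fact fps_add0 : left_id fps_zero fps_add.
Proof. by move=> f; apply/fpsP=> n; apply: add0r. Qed.
Fact fps_addN : left_inverse fps_zero fps_opp fps_add.
Proof. by move=> f; apply/fpsP=> n; apply: addNr. Qed.

HB.instance Definition _ :=
  GRing.isZmodule.Build (fps K) fps_addA fps_addC fps_add0 fps_addN.

Definition fps_one : fps K := FPS (fun n => (n == 0)%:R).
Definition fps_mul f g : fps K :=
  FPS (fun n => \sum_(i < n.+1) fpscoef f i * fpscoef g (n - i)%N).

Definition fps_trunc N f : {poly K} := \poly_(i < N.+1) fpscoef f i.

Lemma coef_fps_trunc N f n : (n <= N)%N -> (fps_trunc N f)`_n = fpscoef f n.
Proof. by move=> le_nN; rewrite coef_poly ltnS le_nN. Qed.

Lemma fps_mul_poly (p r : {poly K}) f g n :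
    (forall i, (i <= n)%N -> p`_i = fpscoef f i) ->
    (forall i, (i <= n)%N -> r`_i = fpscoef g i) ->
  (p * r)`_n = fpscoef (fps_mul f g) n.
Proof.
move=> pE rE; rewrite coefM; apply: eq_bigr => i _.
by rewrite pE -1?ltnS // rE ?leq_subr.
Qed.

Fact fps_mulA : associative fps_mul.
Proof.
move=> f g h; apply/fpsP=> n; have tE := @coef_fps_trunc n.
rewrite -(@fps_mul_poly (fps_trunc n f) (fps_trunc n g * fps_trunc n h));
  [|by move=> i; apply: tE|].
  rewrite mulrA (@fps_mul_poly _ _ (fps_mul f g) h) //;
    last by move=> i; apply: tE.
  by move=> i le_in; apply: fps_mul_poly => j le_ji; apply/tE/(leq_trans le_ji).
by move=> i le_in; apply: fps_mul_poly => j le_ji; apply/tE/(leq_trans le_ji).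
Qed.
Fact fps_mulC : commutative fps_mul.
Proof.
move=> f g; apply/fpsP=> n; have tE := @coef_fps_trunc n.
rewrite -(@fps_mul_poly (fps_trunc n f) (fps_trunc n g)); try by move=> i; apply: tE.
by rewrite mulrC; apply: fps_mul_poly => i; apply: tE.
Qed.
Fact fps_mul1 : left_id fps_one fps_mul.
Proof.
move=> f; apply/fpsP=> n; rewrite /= big_ord_recl /= mul1r subn0.
by rewrite big1 ?addr0 // => i _; rewrite mul0r.
Qed.
Fact fps_mulDl : left_distributive fps_mul fps_add.
Proof.
move=> f g h; apply/fpsP=> n; rewrite /= -big_split /=.
by apply: eq_bigr => i _; rewrite mulrDl.
Qed.
Fact fps_one_neq0 : fps_one != 0.
Proof.
by apply/eqP=> /fpsP/(_ 0%N)/eqP; rewrite /= (oner_eq0 K).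
Qed.

HB.instance Definition _ := GRing.Zmodule_isComNzRing.Build (fps K)
  fps_mulA fps_mulC fps_mul1 fps_mulDl fps_one_neq0.

Lemma fpscoefD f g n : fpscoef (f + g) n = fpscoef f n + fpscoef g n.
Proof. by []. Qed.
Lemma fpscoefN f n : fpscoef (- f) n = - fpscoef f n.
Proof. by []. Qed.
Lemma fpscoef1 n : fpscoef (1 : fps K) n = (n == 0)%:R.
Proof. by []. Qed.
Lemma fpscoefM f g n :
  fpscoef (f * g) n = \sum_(i < n.+1) fpscoef f i * fpscoef g (n - i)%N.
Proof. by []. Qed.
Lemma fpscoef_sum (I : Type) (r : seq I) (P : pred I) (F : I -> fps K) n :
  fpscoef (\sum_(i <- r | P i) F i) n = \sum_(i <- r | P i) fpscoef (F i) n.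
Proof. exact: (big_morph (fun f => fpscoef f n)). Qed.

Lemma fpscoef_expr_small h : fpscoef h 0 = 0 ->
  forall k n, (n < k)%N -> fpscoef (h ^+ k) n = 0.
Proof.
move=> h0; elim=> // k IHk n; rewrite ltnS => le_nk.
rewrite exprS fpscoefM big1 // => -[[|i] /= lt_in] _; first by rewrite h0 mul0r.
by rewrite IHk ?mulr0 //; apply: leq_trans le_nk; rewrite subnS prednK ?subn_gt0 ?leq_subr.
Qed.

Definition fpsC (a : K) : fps K := FPS (fun n => if n == 0%N then a else 0).
Definition fpsX : fps K := FPS (fun n => (n == 1)%:R).

Lemma fpscoefCM a f n : fpscoef (fpsC a * f) n = a * fpscoef f n.
Proof.
rewrite fpscoefM big_ord_recl /= subn0 big1 ?addr0 // => i _.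
by rewrite mul0r.
Qed.

(* sum_k h ^+ k, for h without constant term: the terms with n < k do not
   contribute to the coefficient of degree n *)
Definition fps_geom h : fps K :=
  FPS (fun n => \sum_(k < n.+1) fpscoef (h ^+ k) n).

Lemma fps_geomP h : fpscoef h 0 = 0 -> fps_geom h * (1 - h) = 1.
Proof.
move=> h0; apply/fpsP=> n.
have gE i : (i <= n)%N ->
    fpscoef (fps_geom h) i = fpscoef (\sum_(k < n.+1) h ^+ k) i.
  move=> le_in; rewrite fpscoef_sum /=.
  rewrite (big_ord_widen n.+1 (fun k => fpscoef (h ^+ k) i)) //.
  rewrite big_mkcond; apply: eq_bigr => k _; rewrite ltnS.
  by case: leqP => // lt_ik; rewrite fpscoef_expr_small.
transitivity (fpscoef ((\sum_(k < n.+1) h ^+ k) * (1 - h)) n).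
  rewrite !fpscoefM; apply: eq_bigr => i _.
  by rewrite gE // -ltnS.
rewrite mulrC -opprB mulNr -subrX1 opprB fpscoefD fpscoefN.
by rewrite (fpscoef_expr_small h0) // subr0.
Qed.

Definition fps_unit : {pred fps K} := fun f => fpscoef f 0 != 0.
Definition fps_inv f : fps K :=
  let a := fpsC (fpscoef f 0)^-1 in
  if f \in fps_unit then a * fps_geom (1 - a * f) else f.

Fact fps_mulVf : {in fps_unit, left_inverse 1 fps_inv *%R}.
Proof.
move=> f fU; rewrite /fps_inv fU; set a := fpsC _.
rewrite mulrAC -[in X in X * _](subKr 1 (a * f)) mulrC fps_geomP //.
by rewrite fpscoefD fpscoefN fpscoefCM fpscoef1 mulVf ?subrr.
Qed.
Fact fps_unitP f g : g * f = 1 -> f \in fps_unit.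
Proof.
move/fpsP/(_ 0%N); rewrite fpscoefM big_ord1 fpscoef1 => gf1.
apply: contraTneq isT => f0; move/eqP: gf1.
by rewrite f0 mulr0 eq_sym oner_eq0.
Qed.
Fact fps_inv_out : {in [predC fps_unit], fps_inv =1 id}.
Proof. by move=> f /negbTE fU; rewrite /fps_inv fU. Qed.

HB.instance Definition _ := GRing.ComNzRing_hasMulInverse.Build (fps K)
  fps_mulVf fps_unitP fps_inv_out.

(* f(u^m), for m > 0 *)
Definition fps_subst m f : fps K :=
  FPS (fun n => if (m %| n)%N then fpscoef f (n %/ m) else 0).

(* f = \prod_(k >= 0) F k, the limit being coefficientwise (u-adic) *)
Definition is_fps_prod (F : nat -> fps K) f : Prop :=
  forall n, exists N, forall m, (N <= m)%N ->
    fpscoef (\prod_(k < m) F k) n = fpscoef f n.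

End FpsRing.

Arguments fpsX {K}.

Definition gen_binom (a : rat) (k : nat) : rat :=
  (\prod_(i < k) (a - i%:R)) / (k`!)%:R.

(* f ^ a = sum_k binom(a, k) (f - 1)^k, for f with constant term 1: the terms
   with n < k do not contribute to the coefficient of degree n *)
Definition fps_ratpow (f : fps rat) (a : rat) : fps rat :=
  FPS (fun n => \sum_(k < n.+1) gen_binom a k * fpscoef ((f - 1) ^+ k) n).

Definition c_ser (q : nat) : fps rat := (1 - fpsX) / (1 - q%:R * fpsX).
Definition s_ser (q : nat) : fps rat :=
  (1 - q%:R * fpsX ^+ 2) / ((1 + fpsX) * (1 - q%:R * fpsX)).

Section CombinatorialData.
Variables (F : finFieldType) (n : nat).
Implicit Types (A : 'M[F]_n) (s : seq {poly F}) (d : seq ({poly F} * seq nat)).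

(* 'cV_n, with x acting as A, is isomorphic as an F[x]-module to the direct sum
   of the F[x]/(s_j); an F[x]-linear map is an F-linear map commuting with x *)
Definition module_iso A s : Prop :=
  exists phi : 'cV[F]_n -> {dffun forall j : 'I_(size s), {poly %/ s`_j}},
    [/\ bijective phi,
        forall j, linear (fun v => phi v j)
      & forall v j, phi (A *m v) j = 'qX * phi v j].

Definition is_partition (l : seq nat) : bool := sorted geq l && (0%N \notin l).

Definition is_comb_data A d : Prop :=
  [/\ uniq [seq fl.1 | fl <- d],
      forall fl, fl \in d ->
        [/\ fl.1 \is monic, irreducible_poly fl.1 & fl.1 != 'X]
        /\ is_partition fl.2 /\ fl.2 != [::],
      (\sum_(fl <- d) sumn fl.2 * (size fl.1).-1)%N = n
    & module_iso A [seq fl.1 ^+ k | fl <- d, k <- fl.2]].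

Definition regular A : Prop :=
  exists2 d, is_comb_data A d & {in d, forall fl, size fl.2 = 1%N}.

Definition regular_semisimple A : Prop :=
  exists2 d, is_comb_data A d & {in d, forall fl, fl.2 = [:: 1%N]}.

End CombinatorialData.

Local Open Scope group_scope.

Definition power_image (F : finFieldType) (n M : nat) : {set {'GL_n[F]}} :=
  [set x ^+ M | x in 'GL_n[F]].

(* Only meaningful for n > 0, since {'GL_0[F]} is {'GL_1[F]}. *)
Definition c_rg (F : finFieldType) (n M : nat) : nat :=
  #|[set C in classes 'GL_n[F] |
      [exists A in C, `[< regular (GLval A) >]] && (C \subset power_image F n M)]|.
Definition c_rs (F : finFieldType) (n M : nat) : nat :=
  #|[set C in classes 'GL_n[F] |
      [exists A in C, `[< regular_semisimple (GLval A) >]]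
      && (C \subset power_image F n M)]|.

Lemma unit_of_coprime (M q : nat) :
  (1 < M)%N -> coprime M q -> (q%:R : 'Z_M)%R \is a GRing.unit.
Proof. by move=> M_gt1; rewrite unitZpE. Qed.

Definition order_mod (M q : nat) (M_gt1 : (1 < M)%N) (coMq : coprime M q) : nat :=
  #[FinRing.unit 'Z_M (unit_of_coprime M_gt1 coMq)].

(* Main.v *)
From HB Require Import structures.
Require Import Defs.
From mathcomp Require Import all_boot all_order all_algebra all_fingroup.
From mathcomp Require Import boolp pgroup abelian cyclic separable cyclotomic.
From mathcomp Require Import finfield qpoly qfpoly ring zify.

Set Implicit Arguments.
Unset Strict Implicit.
Unset Printing Implicit Defensive.

Import GRing.Theory.
Local Open Scope ring_scope.

(** A regular matrix makes the space of column vectors a cyclic [F[X]]-module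
    [F[X]/(f)], with [f] monic of degree [n], and [f] determines its conjugacy
    class; the regular semisimple classes are those with [f] squarefree
    ([regularP], [regular_semisimpleP]). Whatever commutes with such a matrix is
    a polynomial in it, so the class consists of [M]-th powers exactly when [X]
    is an [M]-th power modulo [f] ([cyclic_mx_powerP]). By the Chinese remainder
    theorem and a Hensel lifting this holds if and only if [X] is a nonzero
    [M]-th power modulo each irreducible factor of [f] ([factors_in_goodP]). The
    two series therefore enumerate all, respectively the squarefree, monic
    polynomials whose irreducible factors lie in the set of these good ones
    ([card_cyclic_classes]).

    Series are compared through their logarithmic derivatives [u f'(u) / f(u)],
    which together with the constant term determine them ([logder_inj]). For the
    enumerating series, the coefficient of degree [m] is the sum of [deg g] over
    the good irreducible [g] whose degree divides [m] ([count_logder]), that is,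
    the number of nonzero elements of the field with [q^m] elements that are
    [M]-th powers in the field they generate. For the infinite product it is

      [(q^m - 1) + sum_k (1 - M) / M * (q^(m / M^k) - 1)],

    [k] running over the integers such that [M^k t] divides [m] ([product_formula]).
    These numbers agree ([factor_sum_goodE]): when [t] divides [e], a proportion
    [(M - 1) / M] of the nonzero elements of the field with [q^e] elements are
    not [M]-th powers there, and an element that is no [M]-th power in the field
    it generates, of degree [d], is one of these for [e = m / M^k] if and only
    if [k] is the exact exponent of [M] in [m / d] ([level_of_factor]).

    The squarefree case differs only by signs, which amount to replacing a series
    [f(u)] by [f(u) / f(u^2)] on both sides ([factor_sum_squarefree],
    [logder_s]). *)

(** * Logarithmic derivatives of formal power series *)

Section LogDerivative.
Variable K : fieldType.
Implicit Types f g l : fps K.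

(** The operator [u d/du], which preserves degrees. *)
Definition fps_theta f : fps K := FPS (fun n => n%:R * fpscoef f n).

Lemma fpscoef_theta f n : fpscoef (fps_theta f) n = n%:R * fpscoef f n.
Proof. by []. Qed.

Lemma fps_thetaD f g : fps_theta (f + g) = fps_theta f + fps_theta g.
Proof. by apply/fpsP => n /=; rewrite mulrDr. Qed.

Lemma fps_thetaN f : fps_theta (- f) = - fps_theta f.
Proof. by apply/fpsP => n /=; rewrite mulrN. Qed.

Lemma fps_thetaC a : fps_theta (fpsC a) = 0.
Proof. by apply/fpsP => -[|n] /=; rewrite ?mul0r ?mulr0. Qed.

Lemma fpsC1 : fpsC 1 = 1 :> fps K.
Proof. by apply/fpsP => -[|n]. Qed.

Lemma fps_thetaM f g : fps_theta (f * g) = fps_theta f * g + f * fps_theta g.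
Proof.
apply/fpsP => n /=; rewrite mulr_sumr -big_split /=.
apply: eq_bigr => i _; rewrite -{1}(subnKC (_ : i <= n)%N) -1?ltnS // natrD.
by move: (nat_of_ord i)%:R (n - i)%:R => a b; ring.
Qed.

Lemma fps_theta1 : fps_theta 1 = 0.
Proof. by rewrite -fpsC1 fps_thetaC. Qed.

Lemma fps_unitE f : (f \is a GRing.unit) = (fpscoef f 0 != 0).
Proof. by []. Qed.

Lemma fpscoefM0 f g : fpscoef (f * g) 0 = fpscoef f 0 * fpscoef g 0.
Proof. by rewrite fpscoefM big_ord1. Qed.

Lemma fpscoefM_eq f f' g g' n :
    (forall i, (i <= n)%N -> fpscoef f i = fpscoef f' i) ->
    (forall i, (i <= n)%N -> fpscoef g i = fpscoef g' i) ->
  fpscoef (f * g) n = fpscoef (f' * g') n.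
Proof.
move=> ff' gg'; rewrite !fpscoefM; apply: eq_bigr => i _.
by rewrite ff' ?gg' ?leq_subr // -ltnS.
Qed.

(** [l] is [u f'(u) / f(u)], written without a division. *)
Definition logder f l := fps_theta f = f * l.

Lemma logderM f g l m : logder f l -> logder g m -> logder (f * g) (l + m).
Proof. by rewrite /logder fps_thetaM => -> ->; ring. Qed.

Lemma logder1 : logder 1 0.
Proof. by rewrite /logder fps_theta1 mulr0. Qed.

Lemma logderV f l : fpscoef f 0 != 0 -> logder f l -> logder f^-1 (- l).
Proof.
rewrite -fps_unitE => fU fl; apply: (mulrI fU).
have /eqP := fps_thetaM f f^-1.
rewrite mulrV // fps_theta1 fl eq_sym addrC addr_eq0 => /eqP ->.
by rewrite -mulrA mulrCA mulrV // mulr1 mulrA mulrV // mul1r.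
Qed.

Lemma logder_prod (F l : nat -> fps K) m : (forall k, logder (F k) (l k)) ->
  logder (\prod_(k < m) F k) (\sum_(k < m) l k).
Proof.
move=> Fl; elim: m => [|m IHm]; first by rewrite !big_ord0; apply: logder1.
by rewrite !big_ord_recr /=; apply: logderM.
Qed.

Lemma fpscoef_subst m f n : fpscoef (fps_subst m f) n =
  if (m %| n)%N then fpscoef f (n %/ m) else 0.
Proof. by []. Qed.

Lemma fps_substM m f g : (0 < m)%N ->
  fps_subst m (f * g) = fps_subst m f * fps_subst m g.
Proof.
move=> m_gt0; apply/fpsP => n; rewrite fpscoefM [LHS]/=.
have [/dvdnP[k ->]|m'n] := boolP (m %| n)%N; last first.
  rewrite big1 // => i _ /=; case: ifP => [mi|]; rewrite ?mul0r //.
  rewrite ifF ?mulr0 //; apply: contraNF m'n => mni.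
  by rewrite -(subnKC (_ : i <= n)%N) ?dvdn_addr // -ltnS.
rewrite mulnK // -(big_mkord predT (fun i : nat =>
  fpscoef (fps_subst m f) i * fpscoef (fps_subst m g) (k * m - i)%N)).
rewrite -(big_mkord predT (fun i => fpscoef f i * fpscoef g (k - i)%N)).
transitivity (\sum_(i <- [seq (m * j)%N | j <- iota 0 k.+1])
  fpscoef (fps_subst m f) i * fpscoef (fps_subst m g) (k * m - i)%N).
  rewrite big_map /index_iota subn0; apply: eq_big_seq => j.
  rewrite mem_iota add0n ltnS => /andP[_ le_jk] /=.
  by rewrite dvdn_mulr // mulKn // [(m * j)%N]mulnC -mulnBl dvdn_mull // mulnK.
rewrite [RHS](bigID (fun i => (m %| i)%N)) /= [X in _ = _ + X]big1 ?addr0.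
  rewrite -[RHS]big_filter; apply: perm_big; apply: uniq_perm.
  - change (uniq (map (muln m) (iota 0 k.+1)));
      rewrite map_inj_uniq ?iota_uniq // => i j /eqP.
    by rewrite eqn_pmul2l // => /eqP.
  - by rewrite filter_uniq ?iota_uniq.
  move=> i; change (i \in map (muln m) (iota 0 k.+1) =
    (i \in [seq x <- index_iota 0 (k * m).+1 | (m %| x)%N])).
  rewrite mem_filter mem_index_iota ltnS.
  apply/mapP/andP=> [[j]|[/dvdnP[j ->]]].
    rewrite mem_iota add0n ltnS => /andP[_ le_jk] ->.
    by rewrite dvdn_mulr // mulnC leq_mul2r le_jk orbT.
  rewrite leq_pmul2r // => le_jk; exists j; rewrite 1?mulnC //.
  by rewrite mem_iota add0n ltnS.
by move=> i /negPf m'i; rewrite m'i mul0r.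
Qed.

Lemma fps_theta_subst m f :
  fps_theta (fps_subst m f) = fpsC m%:R * fps_subst m (fps_theta f).
Proof.
apply/fpsP => n; rewrite fpscoefCM /=; case: ifP => mn; last by rewrite !mulr0.
by rewrite mulrA -natrM [(m * _)%N]mulnC divnK.
Qed.

Lemma logder_subst m f l : (0 < m)%N -> logder f l ->
  logder (fps_subst m f) (fpsC m%:R * fps_subst m l).
Proof.
move=> m_gt0 fl; rewrite /logder fps_theta_subst fl fps_substM //; ring.
Qed.

Lemma natr_fps (n : nat) : n%:R = fpsC n%:R :> fps K.
Proof.
elim: n => [|n IHn]; first by apply/fpsP => -[|n].
by rewrite !mulrS IHn; apply/fpsP => -[|m] /=; rewrite ?addr0.
Qed.

(** The expansion of [a u / (1 - a u)]. *)
Definition pow_ser (a : K) : fps K :=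
  FPS (fun n => if n == 0%N then 0 else a ^+ n).

Lemma fpscoefXM f n :
  fpscoef (fpsX * f) n = if n == 0%N then 0 else fpscoef f n.-1.
Proof.
rewrite fpscoefM; case: n => [|n]; first by rewrite big_ord1 mul0r.
rewrite big_ord_recl mul0r add0r big_ord_recl /= mul1r subn1 big1 ?addr0 // => i _.
by rewrite mul0r.
Qed.

Lemma logder_1subCX a : logder (1 - fpsC a * fpsX) (- pow_ser a).
Proof.
rewrite /logder fps_thetaD fps_thetaN fps_theta1 fps_thetaM fps_thetaC mul0r !add0r.
rewrite mulrN mulrBl mul1r -mulrA; congr (- _).
have ->: fps_theta (fpsX : fps K) = fpsX.
  by apply/fpsP => -[|[|n]]; rewrite /= ?mulr1 ?mulr0 ?mul0r.
apply/fpsP => n; rewrite fpscoefD fpscoefN !fpscoefCM fpscoefXM.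
by case: n => [|[|n]]; rewrite /= ?mulr0 ?mulr1 ?subr0 -?exprS ?subrr.
Qed.

End LogDerivative.

Section RationalSeries.
Implicit Types f g l : fps rat.

(** In characteristic 0 a series is recovered from its constant term and its
    logarithmic derivative, since the coefficient of degree [n] is [n^-1] times
    a combination of the earlier ones. *)
Lemma logder_inj f g l : fpscoef l 0 = 0 -> logder f l -> logder g l ->
  fpscoef f 0 = fpscoef g 0 -> f = g.
Proof.
move=> l0 fl gl fg0; apply/fpsP; elim/ltn_ind => -[//|n] IHn.
have n0: n.+1%:R != 0 :> rat by rewrite Num.Theory.pnatr_eq0.
apply: (mulfI n0); move/fpsP/(_ n.+1): fl => /= ->.
move/fpsP/(_ n.+1): gl => /= ->.
rewrite big_ord_recr [RHS]big_ord_recr /= subnn l0 !mulr0; congr (_ + _).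
by apply: eq_bigr => i _; rewrite IHn.
Qed.

Lemma logder_small f l k n : logder f l ->
  (forall i, (i <= k)%N -> fpscoef l i = 0) -> (0 < n <= k)%N -> fpscoef f n = 0.
Proof.
case: n => [|n] // fl lk /andP[_ le_nk]; apply/eqP.
have n0: n.+1%:R != 0 :> rat by rewrite Num.Theory.pnatr_eq0.
rewrite -(mulrI_eq0 _ (mulfI n0)); move/fpsP/(_ n.+1): fl => /= ->.
rewrite big1 // => i _; rewrite lk ?mulr0 //.
by rewrite (leq_trans (leq_subr _ _)).
Qed.

Lemma gen_binomS a k : k.+1%:R * gen_binom a k.+1 = (a - k%:R) * gen_binom a k.
Proof.
rewrite /gen_binom big_ord_recr /= factS natrM.
have k0: k.+1%:R != 0 :> rat by rewrite Num.Theory.pnatr_eq0.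
have fk0: (k`!)%:R != 0 :> rat by rewrite Num.Theory.pnatr_eq0 -lt0n fact_gt0.
move: (\prod_(i < k) _) k0 fk0 => P; rewrite -[k.+1%:R]natr1 => k0 fk0.
by field; rewrite fk0 natr1 Num.Theory.pnatr_eq0.
Qed.

Definition ratpow_trunc f a N : fps rat :=
  \sum_(k < N.+1) fpsC (gen_binom a k) * (f - 1) ^+ k.

Lemma coef_ratpow_trunc f a N n : fpscoef f 0 = 1 -> (n <= N)%N ->
  fpscoef (fps_ratpow f a) n = fpscoef (ratpow_trunc f a N) n.
Proof.
move=> f0 le_nN; rewrite fpscoef_sum [LHS]/=.
rewrite (big_ord_widen N.+1 (fun k => gen_binom a k * fpscoef ((f - 1) ^+ k) n)) //.
rewrite big_mkcond; apply: eq_bigr => k _; rewrite fpscoefCM ltnS.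
case: leqP => // lt_nk; rewrite fpscoef_expr_small ?mulr0 //.
by rewrite fpscoefD fpscoefN f0 subrr.
Qed.

Lemma fpsCD (a b : rat) : fpsC (a + b) = fpsC a + fpsC b.
Proof. by apply/fpsP => -[|n] /=; rewrite ?addr0. Qed.
Lemma fpsCN (a : rat) : fpsC (- a) = - fpsC a.
Proof. by apply/fpsP => -[|n] /=; rewrite ?oppr0. Qed.
Lemma fpsCM (a b : rat) : fpsC (a * b) = fpsC a * fpsC b.
Proof. by apply/fpsP => -[|n]; rewrite fpscoefCM /= ?mulr0. Qed.

Lemma fps_thetaX (h : fps rat) k :
  fps_theta (h ^+ k.+1) = k.+1%:R * h ^+ k * fps_theta h.
Proof.
elim: k => [|k IHk]; first by rewrite expr1 expr0; ring.
by rewrite exprS fps_thetaM IHk [h ^+ k.+1]exprS -(natr1 k.+1); ring.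
Qed.

(** The partial sums of the binomial series satisfy the differential equation
    of [f ^ a] up to a multiple of [(f - 1) ^+ N], by [gen_binomS]. *)
Lemma theta_ratpow_trunc f a N :
  fps_theta (ratpow_trunc f a N) * f =
    fpsC a * ratpow_trunc f a N * fps_theta f
      - fpsC ((a - N%:R) * gen_binom a N) * (f - 1) ^+ N * fps_theta f.
Proof.
rewrite /ratpow_trunc; elim: N => [|N IHN].
  rewrite big_ord1 expr0 mulr1 fps_thetaC subr0 fpsCM; ring.
rewrite big_ord_recr /= fps_thetaD mulrDl IHN -gen_binomS fps_thetaM fps_thetaC.
rewrite fps_thetaX fps_thetaD fps_thetaN fps_theta1.
rewrite exprS !fpsCM fpsCD fpsCN -!natr_fps; ring.
Qed.

Lemma ratpow0 f a : fpscoef (fps_ratpow f a) 0 = 1.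
Proof. by rewrite /= big_ord1 /= /gen_binom big_ord0 fact0 divr1 mulr1. Qed.

Lemma logder_ratpow f l a : fpscoef f 0 = 1 -> logder f l ->
  logder (fps_ratpow f a) (fpsC a * l).
Proof.
move=> f0 fl; have fU : f \is a GRing.unit by rewrite fps_unitE f0 oner_eq0.
apply: (mulIr fU); transitivity (fpsC a * fps_ratpow f a * fps_theta f); last first.
  by rewrite fl; ring.
apply/fpsP => n; pose T := ratpow_trunc f a n.+1.
have PT i : (i <= n)%N -> fpscoef (fps_ratpow f a) i = fpscoef T i.
  by move=> le_in; apply: coef_ratpow_trunc => //; apply: leqW.
transitivity (fpscoef (fps_theta T * f) n).
  by apply: fpscoefM_eq => // i le_in; rewrite !fpscoef_theta PT.
transitivity (fpscoef (fpsC a * T * fps_theta f) n); last first.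
  by apply: fpscoefM_eq => // i le_in; rewrite !fpscoefCM PT.
rewrite theta_ratpow_trunc fpscoefD fpscoefN -[X in _ - fpscoef X _]mulrA fpscoefCM.
rewrite [fpscoef ((f - 1) ^+ _ * _) n](_ : _ = 0) ?mulr0 ?subr0 //.
rewrite fpscoefM big1 // => i _; rewrite fpscoef_expr_small ?mul0r //.
by rewrite fpscoefD fpscoefN f0 subrr.
Qed.

(** If the [k]-th logarithmic derivative starts in degree [> k], only finitely
    many factors matter in each degree. *)
Lemma fps_prod_logder (F l : nat -> fps rat) :
    (forall k, fpscoef (F k) 0 = 1) -> (forall k, logder (F k) (l k)) ->
    (forall k n, (n <= k)%N -> fpscoef (l k) n = 0) ->
  exists P, [/\ is_fps_prod F P, fpscoef P 0 = 1
    & logder P (FPS (fun n => \sum_(k < n.+1) fpscoef (l k) n))].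
Proof.
move=> F0 Fl lk.
have F_small k n : (0 < n <= k)%N -> fpscoef (F k) n = 0.
  by apply: (logder_small (Fl k)) => i; apply: lk.
pose Q m := \prod_(k < m) F k.
have Qstab m n : (n <= m)%N -> fpscoef (Q m) n = fpscoef (Q n) n.
  move=> le_nm; rewrite -(subnK le_nm); elim: (m - n)%N => // d IHd.
  rewrite addSn /Q big_ord_recr /= -IHd -/(Q _) -[LHS](fpscoefM (Q (d + n)) (F _)).
  rewrite -[in RHS](mulr1 (Q _)); apply: fpscoefM_eq => // -[|i] le_in; rewrite ?F0 //.
  by rewrite F_small //= (leq_trans le_in) // leq_addl.
pose P : fps rat := FPS (fun n => fpscoef (Q n) n).
exists P; split.
- by move=> n; exists n => m le_nm; apply: Qstab.
- by rewrite /= /Q big_ord0.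
apply/fpsP => n; transitivity (fpscoef (fps_theta (Q n.+1)) n).
  by rewrite !fpscoef_theta (Qstab n.+1).
rewrite (logder_prod n.+1 Fl); apply: fpscoefM_eq => i le_in.
  by rewrite [RHS]/= -/(Q n.+1) (Qstab n.+1) // leqW.
rewrite fpscoef_sum /= [RHS](big_ord_widen n.+1 (fun k => fpscoef (l k) i)) //.
rewrite [RHS]big_mkcond; apply: eq_bigr => k _ /=; rewrite ltnS.
by case: leqP => // lt_ik; rewrite lk // ltnW.
Qed.

(** The coefficient of degree [n > 0] is the number of nonzero elements of a
    field of degree [n] over a field with [q] elements. *)
Definition c_log (q : nat) : fps rat :=
  FPS (fun n => if n == 0%N then 0 else q%:R ^+ n - 1).

Lemma coef0_1subCX (a : rat) : fpscoef (1 - fpsC a * fpsX) 0 = 1.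
Proof. by rewrite fpscoefD fpscoefN fpscoefCM mulr0 subr0. Qed.

Lemma fpscoefV0 f : fpscoef f 0 = 1 -> fpscoef f^-1 0 = 1.
Proof.
move=> f0; have fU : f \is a GRing.unit by rewrite fps_unitE f0 oner_eq0.
by rewrite -[LHS]mul1r -{1}f0 -fpscoefM0 mulrV.
Qed.

Lemma c_ser0 q : fpscoef (c_ser q) 0 = 1.
Proof.
rewrite /c_ser natr_fps fpscoefM0 (fpscoefV0 (coef0_1subCX _)) mulr1.
by rewrite fpscoefD fpscoefN subr0.
Qed.

(** A quotient of series to which [logder_subst] and [logder_1subCX] apply. *)
Lemma s_serE q : s_ser q = fps_subst 2 (1 - fpsC q%:R * fpsX)
  / ((1 - fpsC (-1) * fpsX) * (1 - fpsC q%:R * fpsX)).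
Proof.
rewrite /s_ser natr_fps fpsCN fpsC1 mulN1r opprK; congr (_ / _).
rewrite expr2; apply/fpsP => n; rewrite fpscoef_subst.
rewrite !fpscoefD !fpscoefN !fpscoefCM fpscoefXM.
case: n => [|[|n]]; rewrite ?mulr0 ?subr0 //= -[n.+2]addn2 divnDr // divnn /= !addn1.
rewrite dvdn2 oddD addbF; case: n => [|[|n]] //=; rewrite ?mulr0 ?subr0 //.
rewrite -[n.+2]addn2 divnDr // divnn addn1 mulr0 subr0.
by case: ifP.
Qed.

Lemma s_ser0 q : fpscoef (s_ser q) 0 = 1.
Proof.
rewrite s_serE fpscoefM0 (fpscoefV0 (_ : fpscoef (_ * _) 0 = 1)) ?mulr1.
  exact: coef0_1subCX.
by rewrite fpscoefM0 !coef0_1subCX mulr1.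
Qed.

Lemma logder_c q : logder (c_ser q) (c_log q).
Proof.
have ->: c_log q = - pow_ser 1 + - - pow_ser q%:R.
  apply/fpsP => -[|n]; first by rewrite /= oppr0 !addr0.
  by rewrite /= opprK expr1n addrC.
rewrite /c_ser natr_fps; apply: logderM.
  by have := logder_1subCX (1 : rat); rewrite fpsC1 mul1r.
by apply: logderV (logder_1subCX _); rewrite coef0_1subCX oner_eq0.
Qed.

(** The operator [f(u) |-> f(u) / f(u^2)], seen on logarithmic derivatives: it
    turns [1 / (1 - x)] into [1 + x]. *)
Definition mod_square l : fps rat := l - 2%:R * fps_subst 2 l.

Lemma coef_mod_square l n : fpscoef (mod_square l) n =
  fpscoef l n - (if (2 %| n)%N then 2%:R * fpscoef l (n %/ 2) else 0).
Proof.
rewrite fpscoefD fpscoefN natr_fps fpscoefCM /=.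
by case: ifP => // _; rewrite mulr0.
Qed.

Lemma logder_s q : logder (s_ser q) (mod_square (c_log q)).
Proof.
have ->: mod_square (c_log q) = fpsC 2%:R * fps_subst 2 (- pow_ser q%:R)
    + - (- pow_ser (-1) + - pow_ser q%:R).
  apply/fpsP => n; rewrite coef_mod_square fpscoefD fpscoefCM fpscoefN fpscoefD.
  rewrite !fpscoefN /=; case: n => [|n].
    by rewrite div0n /=; ring.
  have [/dvdnP[m ->]|n'2] := boolP (2 %| n.+1)%N; last first.
    rewrite -signr_odd; have -> : odd n.+1 by move: n'2; rewrite dvdn2 negbK.
    by rewrite /= expr1; ring.
  rewrite mulnK // muln_eq0 orbF -[(-1) ^+ (m * 2)]signr_odd oddM andbF expr0.
  by case: eqP => _; ring.
rewrite s_serE; apply: logderM; first exact: logder_subst (logder_1subCX _).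
apply: logderV; last by apply: logderM; apply: logder_1subCX.
by rewrite fpscoefM0 !coef0_1subCX mulr1 oner_eq0.
Qed.

(** In the logarithmic derivative of the [k]-th factor the substitution of
    [u ^ (M ^ k * t)] brings out [M ^ k * t], which reduces the exponent to
    [(1 - M) / M]. *)
Lemma product_formula (ser lser : nat -> fps rat) (M q t : nat) (A : fps rat) :
    (1 < M)%N -> (0 < t)%N -> (forall r, fpscoef (ser r) 0 = 1) ->
    (forall r, fpscoef (lser r) 0 = 0) -> (forall r, logder (ser r) (lser r)) ->
    fpscoef A 0 = 1 ->
    logder A (FPS (fun n => fpscoef (lser q) n + \sum_(k < n.+1)
      (1 - M%:R) / M%:R * fpscoef (fps_subst (M ^ k * t) (lser (q ^ t)%N)) n)) ->
  exists2 P : fps rat,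
     is_fps_prod (fun k => fps_ratpow (fps_subst (M ^ k * t) (ser (q ^ t)%N))
                             ((1 - M%:R) / (M ^ k.+1 * t)%:R)) P
   & A = ser q * P.
Proof.
move=> M_gt1 t_gt0 ser0 lser0 serl A0 AL.
have mt_gt0 k : (0 < M ^ k * t)%N by rewrite muln_gt0 expn_gt0 ltnW.
set F := fun k => fps_ratpow _ _.
pose l k := fpsC ((1 - M%:R) / M%:R : rat) * fps_subst (M ^ k * t) (lser (q ^ t)%N).
have Fl k : logder (F k) (l k).
  have ->: l k = fpsC ((1 - M%:R) / (M ^ k.+1 * t)%:R)
      * (fpsC (M ^ k * t)%:R * fps_subst (M ^ k * t) (lser (q ^ t)%N)).
    rewrite /l mulrA -fpsCM; congr (fpsC _ * _).
    rewrite expnS -[(M * _ * t)%N]mulnA natrM; field.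
    have M_gt0 := ltnW M_gt1.
    by rewrite !Num.Theory.pnatr_eq0 -!lt0n expn_gt0 t_gt0 M_gt0.
  apply: logder_ratpow; first by rewrite /= dvdn0 div0n.
  exact: logder_subst.
have lk k n : (n <= k)%N -> fpscoef (l k) n = 0.
  move=> le_nk; rewrite /l fpscoefCM /=; case: ifP => [|_]; last by rewrite mulr0.
  case: n le_nk => [|n] le_nk; first by rewrite div0n lser0 mulr0.
  move/(dvdn_leq (ltn0Sn n)); rewrite leqNgt => /negP[].
  rewrite (leq_ltn_trans le_nk) // (leq_trans (ltn_expl k M_gt1)) //.
  by rewrite leq_pmulr.
have [P [FP P0 PL]] := fps_prod_logder (fun k => ratpow0 _ _) Fl lk.
exists P => //; apply: (logder_inj _ AL); last by rewrite fpscoefM0 ser0 P0 mulr1.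
  by rewrite /= lser0 big_ord1 /= dvdn0 div0n lser0 mulr0 addr0.
have -> : FPS (fun n => fpscoef (lser q) n + \sum_(k < n.+1)
      (1 - M%:R) / M%:R * fpscoef (fps_subst (M ^ k * t) (lser (q ^ t)%N)) n)
  = lser q + FPS (fun n => \sum_(k < n.+1) fpscoef (l k) n).
  apply/fpsP => n; rewrite fpscoefD; congr (_ + _).
  by apply: eq_bigr => k _; rewrite fpscoefCM.
exact: logderM.
Qed.

End RationalSeries.

(** * Monic polynomials over a finite field and their irreducible factors *)

Section MonicPolynomials.
Variable F : finFieldType.
Implicit Types (f g h p : {poly F}) (G P : pred {poly F}) (n : nat).

Definition deg f : nat := (size f).-1.

Definition polys_upto (n : nat) : seq {poly F} :=
  [seq rVpoly v | v <- enum 'rV[F]_n.+1].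
Definition monics (n : nat) := [seq f <- polys_upto n | (f \is monic) && (deg f == n)].
Definition irred g := irreducibleb g && (g \is monic).
Definition irreds (n : nat) := [seq g <- polys_upto n | irred g].

Lemma mem_polys_upto n f : (f \in polys_upto n) = (deg f <= n)%N.
Proof.
have -> : (deg f <= n)%N = (size f <= n.+1)%N by rewrite /deg; case: (size f).
apply/mapP/idP => [[v _ ->]|sf]; first exact: size_poly.
by exists (poly_rV f); rewrite ?mem_enum // poly_rV_K.
Qed.

Lemma uniq_polys_upto n : uniq (polys_upto n).
Proof. by rewrite map_inj_uniq ?enum_uniq //; apply: can_inj rVpolyK. Qed.

Lemma mem_monics n f : (f \in monics n) = (f \is monic) && (deg f == n).
Proof.
rewrite mem_filter mem_polys_upto; case: (f \is monic) => //=.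
by case: eqP => // ->; rewrite leqnn.
Qed.

Lemma uniq_monics n : uniq (monics n).
Proof. by rewrite filter_uniq ?uniq_polys_upto. Qed.

Lemma mem_irreds n g : (g \in irreds n) = irred g && (deg g <= n)%N.
Proof. by rewrite mem_filter mem_polys_upto. Qed.

Lemma uniq_irreds n : uniq (irreds n).
Proof. by rewrite filter_uniq ?uniq_polys_upto. Qed.

Lemma irredP g : reflect (irreducible_poly g /\ g \is monic) (irred g).
Proof. by apply: (iffP andP) => -[/irreducibleP irr_g mon_g]. Qed.

Lemma irred_monic g : irred g -> g \is monic. Proof. by case/andP. Qed.

Lemma irred_neq0 g : irred g -> g != 0.
Proof. by move/irred_monic/monic_neq0. Qed.

Lemma irred_deg_gt0 g : irred g -> (0 < deg g)%N.
Proof. by case/irredP => -[sg _] _; rewrite /deg -ltnS prednK // ltnW. Qed.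

Lemma monic_deg0 f : f \is monic -> deg f = 0%N -> f = 1.
Proof.
rewrite /deg => /monicP; rewrite lead_coefE => lf df; rewrite df in lf.
by rewrite (@size1_polyC _ f) ?lf //; move: df; case: (size f) => [|[]].
Qed.

Lemma size_deg f : f != 0 -> size f = (deg f).+1.
Proof. by rewrite -size_poly_gt0 /deg => /prednK. Qed.

Lemma degM f g : f != 0 -> g != 0 -> deg (f * g) = (deg f + deg g)%N.
Proof. by move=> f0 g0; rewrite /deg size_mul // !size_deg // addnS. Qed.

Lemma leq_deg f g : f != 0 -> g %| f -> (deg g <= deg f)%N.
Proof.
move=> f0 gf; have := dvdp_leq f0 gf.
by rewrite (size_deg f0) (size_deg (dvdpN0 gf f0)).
Qed.

Lemma irred_coprime g h : irred g -> coprimep g h = ~~ (g %| h).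
Proof. by case/irredP=> irr_g _; apply: irreducible_poly_coprime. Qed.

Lemma irred_dvd g h : irred g -> irred h -> (g %| h) = (g == h).
Proof.
move=> /irredP[ig mg] /irredP[ih mh]; apply/idP/eqP => [gh|->]; last exact: dvdpp.
apply/eqP; rewrite -eqp_monic //; apply: ih => //.
by have [sg _] := ig; rewrite neq_ltn sg orbT.
Qed.

Lemma irred_dvdM g f h : irred g -> (g %| f * h) = (g %| f) || (g %| h).
Proof.
move=> ig; have [gf|] := boolP (g %| f); first by rewrite dvdp_mulr.
by rewrite -irred_coprime // => gf; rewrite Gauss_dvdpr.
Qed.

Lemma monicMl_div g f : g \is monic -> f \is monic -> g %| f ->
  exists2 h, h \is monic & f = g * h.
Proof.
move=> mg mf gf; exists (f %/ g); last by rewrite mulrC divpK.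
by rewrite -(monicMr _ mg) divpK.
Qed.

Lemma exists_irred_factor f : f \is monic -> (0 < deg f)%N ->
  exists2 g, irred g & g %| f.
Proof.
elim: {f}(deg f) {-2}f (leqnn (deg f)) => [|n IHn] f.
  by rewrite leqn0 lt0n => ->.
move=> df mf df0; have [irr_f|] := boolP (irred f); first by exists f.
rewrite /irred mf andbT negb_and.
have f1 : (1 < size f)%N by rewrite size_deg ?monic_neq0.
rewrite f1 /= negb_forall => /existsP[p0]; rewrite negb_imply -ltnNge.
rewrite -Pdiv.Idomain.dvdpE => /andP[p0f p01].
have [p pf /andP[p1 p_small]] : exists2 p : {poly F}, p %| f & (1 < size p < size f)%N.
  exists (p0 : {poly F}) => //; rewrite p01 /=.
  by rewrite -[X in (_ < X)%N]prednK ?ltnS ?size_npoly // ltnW.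
move=> {p0 p0f p01}.
have p0 : p != 0 by rewrite -size_poly_gt0 ltnW.
pose p' := (lead_coef p)^-1 *: p.
have l0 : (lead_coef p)^-1 != 0 by rewrite invr_eq0 lead_coef_eq0.
have dp' : deg p' = deg p by rewrite /deg size_scale.
have p'f : p' %| f by rewrite dvdpZl.
have mp' : p' \is monic by rewrite monicE lead_coefZ mulVf // -invr_eq0.
have [|//||g ig gp'] := IHn p'; rewrite ?dp'.
- by rewrite -ltnS (leq_trans _ df) //; move: p_small p1; rewrite /deg; lia.
- by move: p1; rewrite /deg; lia.
by exists g => //; apply: dvdp_trans p'f.
Qed.

(** Statements on factorisations follow by multiplying by one irreducible
    polynomial at a time. *)
Lemma monic_irred_ind (Q : {poly F} -> Prop) : Q 1 ->
    (forall g h, irred g -> h \is monic -> Q h -> Q (g * h)) ->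
  forall f, f \is monic -> Q f.
Proof.
move=> Q1 QM f; elim: {f}(deg f) {-2}f (leqnn (deg f)) => [|n IHn] f df mf.
  by rewrite (monic_deg0 mf) //; apply/eqP; rewrite -leqn0.
have [/eqP df0|] := posnP (deg f); first by rewrite (monic_deg0 mf) ?(eqP df0).
move=> /(exists_irred_factor mf)[g ig gf].
have [h mh f_gh] := monicMl_div (irred_monic ig) mf gf.
rewrite f_gh; apply: QM => //; apply: IHn => //.
move: df; rewrite f_gh degM ?monic_neq0 ?(irred_monic ig) //.
by have := irred_deg_gt0 ig; lia.
Qed.

(** The multiplicity of an irreducible [g] as a factor of [f]: its powers
    dividing [f] are those of exponent at most this, and all of them are counted
    since [g ^+ j] has degree at least [j]. *)
Definition mult g f : nat := (\sum_(1 <= j < size f) (g ^+ j %| f)%R)%N.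

Lemma size_exp_irred g j : irred g -> (j < size (g ^+ j))%N.
Proof.
move=> ig; have g0 := irred_neq0 ig; rewrite size_deg ?expf_neq0 // ltnS.
rewrite /deg size_exp; have := irred_deg_gt0 ig; rewrite /deg.
by case: (size g).-1 => // n _; rewrite leq_pmull.
Qed.

Lemma mult_widen g f n : irred g -> f != 0 -> (size f <= n)%N ->
  mult g f = (\sum_(1 <= j < n) (g ^+ j %| f)%R)%N.
Proof.
move=> ig f0 le_fn; have f1: (0 < size f)%N by rewrite size_poly_gt0.
rewrite (big_cat_nat f1 le_fn) /= [X in (_ + X)%N]big_nat_cond.
rewrite [X in (_ + X)%N]big1 ?addn0 //.
move=> j /andP[/andP[fj _] _]; apply/eqP; rewrite eqb0; apply/negP=> /(dvdp_leq f0).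
by rewrite leqNgt (leq_ltn_trans fj) ?size_exp_irred.
Qed.

Lemma mult1 g : mult g 1 = 0%N.
Proof. by rewrite /mult size_poly1 big_geq. Qed.

Lemma mult_irredM g k h : irred g -> irred k -> h != 0 ->
  mult g (k * h) = ((g == k) + mult g h)%N.
Proof.
move=> ig ik h0; have k0 := irred_neq0 ik; have kh0 : k * h != 0 by rewrite mulf_neq0.
have le_h : (size h < size (k * h)%R)%N.
  by rewrite !size_deg // ltnS degM // -add1n leq_add2r irred_deg_gt0.
case: eqP => [gk|/eqP gk]; last first.
  rewrite (mult_widen ig h0 (ltnW le_h)) add0n; apply: eq_bigr => j _.
  by rewrite Gauss_dvdpr // coprimep_expl // irred_coprime // irred_dvd.
have h1 : (0 < size h)%N by rewrite size_poly_gt0.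
rewrite -gk in k0 kh0 le_h *; rewrite {1}/mult.
have -> : size (g * h) = (size (g * h)).-1.+1 by rewrite size_deg.
rewrite big_nat_recl ?expr1 ?dvdp_mulr //; last by lia.
congr (_ + _)%N; rewrite (mult_widen (n := (size (g * h)).-1) ig h0); last by lia.
by apply: eq_bigr => j _; rewrite exprS dvdp_mul2l.
Qed.

Lemma mult_gt0 g f : irred g -> f != 0 -> (0 < mult g f)%N = (g %| f)%R.
Proof.
move=> ig f0; apply/idP/idP => [|gf].
  apply: contraLR => gf; rewrite -eqn0Ngt; apply/eqP.
  rewrite /mult big_nat big1 // => -[|j] // _; apply/eqP; rewrite eqb0.
  by apply: contra gf; apply: dvdp_trans; rewrite dvdp_exp.
have f1 : (1 < size f)%N.
  by apply: leq_trans (dvdp_leq f0 gf); case/irredP: ig => -[].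
by rewrite /mult big_ltn // expr1 gf.
Qed.

Lemma dvd_exp_mult g j f : irred g -> f != 0 ->
  g ^+ j %| f -> (j <= mult g f)%N.
Proof.
move=> ig f0 gf; have jf : (j < size f)%N.
  by apply: leq_trans (dvdp_leq f0 gf); apply: size_exp_irred.
rewrite /mult (@big_cat_nat _ _ _ j.+1) //= -[X in (X <= _)%N]addn0 leq_add //.
rewrite big_nat (eq_bigr (fun _ => 1%N)); 
  first by rewrite -big_nat sum1_size size_iota subn1.
move=> i /andP[_ ij]; rewrite (dvdp_trans _ gf) //.
by rewrite dvdp_exp2l.
Qed.

Lemma monic_factorization f n : f \is monic -> (deg f <= n)%N ->
  f = \prod_(g <- irreds n) g ^+ mult g f.
Proof.
move=> mf; elim/monic_irred_ind: f / mf => [|k h ik mh IHh] df.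
  by rewrite big1 // => g _; rewrite mult1.
have [k0 h0] := (irred_neq0 ik, monic_neq0 mh).
have [dk dh] : (deg k <= n)%N /\ (deg h <= n)%N by move: df; rewrite degM //; lia.
have kn : k \in irreds n by rewrite mem_irreds ik.
rewrite {1}(IHh dh) !(bigD1_seq k) ?uniq_irreds //= mult_irredM // eqxx exprS.
rewrite -mulrA; congr (_ * (_ * _)); rewrite big_seq_cond [RHS]big_seq_cond.
apply: eq_bigr => g /andP[]; rewrite mem_irreds => /andP[ig _] /negPf gk.
by rewrite mult_irredM // gk.
Qed.

Lemma deg_sum_mult f n : f \is monic -> (deg f <= n)%N ->
  deg f = (\sum_(g <- irreds n) mult g f * deg g)%N.
Proof.
move=> mf; elim/monic_irred_ind: f / mf => [|k h ik mh IHh] df.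
  by rewrite /deg size_poly1 big1 // => g _; rewrite mult1.
have [k0 h0] := (irred_neq0 ik, monic_neq0 mh).
have [dk dh] : (deg k <= n)%N /\ (deg h <= n)%N by move: df; rewrite degM //; lia.
have kn : k \in irreds n by rewrite mem_irreds ik.
rewrite degM // (IHh dh) !(bigD1_seq k) ?uniq_irreds //= mult_irredM // eqxx.
rewrite mulnDl mul1n -addnA; congr (_ + (_ + _))%N.
rewrite big_seq_cond [RHS]big_seq_cond.
apply: eq_bigr => g /andP[]; rewrite mem_irreds => /andP[ig _] /negPf gk.
by rewrite mult_irredM // gk.
Qed.

Definition factors_in G f := all (fun g => (g %| f) ==> G g) (irreds (deg f)).

Lemma factors_inP G f : f != 0 ->
  reflect (forall g, irred g -> g %| f -> G g) (factors_in G f).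
Proof.
move=> f0; apply: (iffP allP) => Gf g.
  by move=> ig gf; have := Gf g; rewrite mem_irreds ig leq_deg // gf; apply.
by rewrite mem_irreds => /andP[ig _]; apply/implyP; apply: Gf.
Qed.

Definition squarefree f := all (fun g => ~~ (g ^+ 2 %| f)) (irreds (deg f)).

Lemma squarefreeP f : f != 0 ->
  reflect (forall g, irred g -> (mult g f <= 1)%N) (squarefree f).
Proof.
move=> f0; apply: (iffP allP) => sf g; last first.
  rewrite mem_irreds => /andP[ig _]; apply/negP => /dvd_exp_mult -/(_ ig f0).
  by have := sf g ig; lia.
move=> ig; rewrite leqNgt; apply/negP => m2.
have gf : g %| f by rewrite -mult_gt0 //; lia.
have := sf g; rewrite mem_irreds ig leq_deg // => /(_ isT) /negP; apply.
apply: contraTT m2 => g2; rewrite -leqNgt /mult.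
have sf1 : (1 < size f)%N.
  by apply: leq_trans (dvdp_leq f0 gf); case/irredP: ig => -[].
rewrite big_ltn // big_nat big1 => [|j /andP[j2 _]]; first by case: (_ %| _).
apply/eqP; rewrite eqb0; apply: contra g2; apply: dvdp_trans.
by rewrite dvdp_exp2l.
Qed.

Lemma factors_in_irredM G g h : irred g -> h != 0 ->
  factors_in G (g * h) = G g && factors_in G h.
Proof.
move=> ig h0; have gh0 : g * h != 0 by rewrite mulf_neq0 ?(irred_neq0 ig).
apply/(factors_inP _ gh0)/andP => [Gf|[Gg /(factors_inP _ h0) Gh] k ik].
  split; first by apply: Gf => //; apply: dvdp_mulr.
  by apply/factors_inP => // k ik kh; apply: Gf => //; apply: dvdp_mull.
by rewrite irred_dvdM // irred_dvd // => /orP[/eqP -> //|]; apply: Gh.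
Qed.

Lemma squarefree_irredM g h : irred g -> h != 0 ->
  squarefree (g * h) = squarefree h && ~~ (g %| h).
Proof.
move=> ig h0; have gh0 : g * h != 0 by rewrite mulf_neq0 ?(irred_neq0 ig).
rewrite -mult_gt0 // -leqNgt.
apply/(squarefreeP gh0)/andP => [sf|[/(squarefreeP h0) sh mg] k ik].
  split; last by have := sf g ig; rewrite mult_irredM // eqxx.
  by apply/squarefreeP => // k ik; have := sf k ik; rewrite mult_irredM //; lia.
rewrite mult_irredM //; case: eqP => [->|_]; last exact: sh.
by move: mg; rewrite leqn0 => /eqP ->.
Qed.

(** Multiplication by [g] is a bijection from the cofactors to the multiples. *)
Lemma sum_multiples (R : nmodType) (g : {poly F}) n (P : pred {poly F})
    (w : {poly F} -> R) : g \is monic ->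
  \sum_(f <- monics n | P f && (g %| f)) w f =
  if (deg g <= n)%N then \sum_(h <- monics (n - deg g) | P (g * h)) w (g * h)
  else 0.
Proof.
move=> mg; have g0 := monic_neq0 mg; case: leqP => gn; last first.
  rewrite big_seq_cond big1 // => f; rewrite mem_monics.
  case/andP=> /andP[/monic_neq0 f0 /eqP df] /andP[_ gf]; move: gn.
  by rewrite -df ltnNge leq_deg.
rewrite -[LHS]big_filter -[RHS]big_filter -[RHS](big_map (fun h => g * h) predT w).
apply: perm_big; apply: uniq_perm.
- by rewrite filter_uniq ?uniq_monics.
- by rewrite map_inj_uniq; [rewrite filter_uniq ?uniq_monics | apply: mulfI].
move=> f; rewrite mem_filter mem_monics; apply/idP/mapP.
  case/andP=> /andP[Pf gf] /andP[mf /eqP df].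
  have [h mh f_gh] := monicMl_div mg mf gf; exists h => //.
  rewrite mem_filter -f_gh Pf mem_monics mh -df f_gh degM ?monic_neq0 //.
  by rewrite addKn eqxx.
move=> [h]; rewrite mem_filter mem_monics => /andP[Ph /andP[mh /eqP dh]] ->.
by rewrite Ph dvdp_mulr // monicMl // mh degM ?monic_neq0 // dh subnKC ?eqxx.
Qed.

(** Counting the pairs formed by a polynomial of a multiplicative family and one
    of its irreducible factors gives the coefficients of the logarithmic
    derivative of the generating function. The sign [e] is [1] for all
    polynomials with factors in [G] and [-1] for the squarefree ones. *)
Section Counting.
Variables (G P : pred {poly F}) (e : rat).
Hypothesis PG : forall f g, f \is monic -> P f -> irred g -> g %| f -> G g.
Hypothesis P_mult : forall g n, irred g -> G g ->
  \sum_(h <- monics n | P (g * h)) (mult g (g * h))%:R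
    = \sum_(h <- monics n | P h) (1 + e * (mult g h)%:R) :> rat.

Let w n : rat := (count P (monics n))%:R.
Let c g n : rat := \sum_(f <- monics n | P f) (mult g f)%:R.

(** The members of the family that [g] divides are obtained from those of degree
    lower by [deg g]: for [e = 1] all of these are multiplied by [g], which raises
    the multiplicity by one; for [e = -1] only those prime to [g] are. *)
Lemma sum_mult_rec g n : irred g -> G g ->
  c g n = if (deg g <= n)%N then w (n - deg g) + e * c g (n - deg g) else 0.
Proof.
move=> ig Gg; rewrite {1}/c (bigID (fun f => g %| f)) /= [X in _ + X]big1_seq.
  rewrite addr0 sum_multiples ?irred_monic //; case: leqP => // le_gn.
  rewrite P_mult // big_split /= -mulr_sumr; congr (_ + _).
  by rewrite /w -sum1_count natr_sum.
move=> f /andP[/andP[_ gf]]; rewrite mem_monics => /andP[/monic_neq0 f0 _].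
by have := mult_gt0 ig f0; rewrite (negPf gf) lt0n => /negbFE/eqP ->.
Qed.

Lemma sum_multE g n : irred g -> G g ->
  c g n = \sum_(1 <= m < n.+1 | (deg g %| m)%N) e ^+ (m %/ deg g).-1 * w (n - m).
Proof.
move=> ig Gg; have d0 := irred_deg_gt0 ig; set d := deg g in d0 *.
elim/ltn_ind: n => n IHn; rewrite sum_mult_rec // -/d; case: leqP => le_dn; last first.
  rewrite big_nat_cond big1 // => m /andP[/andP[m0 mn] dm].
  by have := dvdn_leq m0 dm; lia.
rewrite IHn; last by lia.
rewrite [RHS](@big_cat_nat _ _ _ d.+1) //=; congr (_ + _).
  rewrite big_mkcond big_nat_recr //= dvdnn divnn d0 /= mul1r big_nat big1 ?add0r //.
  move=> m /andP[m0 mn]; case: ifP => // dm.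
  by have := dvdn_leq m0 dm; lia.
rewrite -(add1n d) big_addn (_ : n.+1 - d = (n - d).+1)%N; last by lia.
rewrite mulr_sumr.
rewrite [LHS]big_nat_cond [RHS]big_nat_cond; apply: eq_big => m.
  by rewrite dvdn_addl ?dvdnn.
move=> /andP[/andP[m0 mn] dm]; rewrite mulrA; congr (_ * w _); last by lia.
rewrite divnDr // divnn d0 addn1 -exprS prednK // divn_gt0 //.
exact: dvdn_leq.
Qed.

Definition factor_sum m : rat :=
  \sum_(g <- irreds m | G g && (deg g %| m)%N) (deg g)%:R * e ^+ (m %/ deg g).-1.

(** The degree of a polynomial is the sum of the degrees of its irreducible
    factors with multiplicity; summing this over the family and exchanging the
    sums reduces to [sum_multE]. *)
Lemma count_logder n :
  n%:R * w n = \sum_(1 <= m < n.+1) w (n - m) * factor_sum m.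
Proof.
transitivity (\sum_(g <- irreds n | G g) (deg g)%:R * c g n).
  rewrite /w -sum1_count natr_sum mulr_sumr.
  transitivity (\sum_(f <- monics n | P f)
      \sum_(g <- irreds n | G g) (deg g)%:R * (mult g f)%:R : rat).
    rewrite big_seq_cond [RHS]big_seq_cond; apply: eq_bigr => f.
    rewrite mem_monics => /andP[/andP[mf /eqP df] Pf]; rewrite mulr1 -{1}df.
    rewrite (@deg_sum_mult f n) ?df // natr_sum [RHS]big_mkcond /=.
    rewrite big_seq [RHS]big_seq; apply: eq_bigr => g.
    rewrite mem_irreds => /andP[ig _].
    rewrite natrM mulrC; case: ifP => // /negP G'g.
    have [->|] := posnP (mult g f); first by rewrite mulr0.
    by rewrite mult_gt0 ?monic_neq0 // => gf; case: G'g; apply: PG gf.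
  by rewrite exchange_big; apply: eq_bigr => g _; rewrite mulr_sumr.
transitivity (\sum_(g <- irreds n | G g) \sum_(1 <= m < n.+1 | (deg g %| m)%N)
    w (n - m) * ((deg g)%:R * e ^+ (m %/ deg g).-1)).
  rewrite big_seq_cond [RHS]big_seq_cond; apply: eq_bigr => g.
  rewrite mem_irreds => /andP[/andP[ig _] Gg]; rewrite sum_multE // mulr_sumr.
  by apply: eq_bigr => m _; ring.
rewrite (exchange_big_dep xpredT) //= big_nat [RHS]big_nat.
apply: eq_bigr => m /andP[m0 mn].
rewrite -mulr_sumr; congr (_ * _).
rewrite /factor_sum -[LHS]big_filter -[RHS]big_filter.
apply: perm_big; apply: uniq_perm; [exact/filter_uniq/uniq_irreds..|].
move=> g; rewrite [LHS]mem_filter [RHS]mem_filter !mem_irreds.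
  case: (irred g); rewrite ?andbF //=.
case: (G g) => //=; case: (boolP (_ %| _)%N) => //= /(dvdn_leq m0) gm.
by rewrite gm (leq_trans gm).
Qed.

End Counting.

Lemma count_factors_in_logder G n :
  n%:R * (count (factors_in G) (monics n))%:R =
  \sum_(1 <= m < n.+1) (count (factors_in G) (monics (n - m)))%:R * factor_sum G 1 m.
Proof.
apply: count_logder => [f g /monic_neq0 f0 /(factors_inP G f0)|g m ig Gg].
  exact.
rewrite big_seq_cond [RHS]big_seq_cond; apply: eq_big => h.
  rewrite mem_monics; case: (boolP (h \is monic)) => //= /monic_neq0 h0.
  by rewrite factors_in_irredM // Gg.
rewrite mem_monics => /andP[/andP[/monic_neq0 h0 _] _].
by rewrite mult_irredM // eqxx natrD mul1r.
Qed.

Lemma count_squarefree_logder G (P := fun f => factors_in G f && squarefree f) n :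
  n%:R * (count P (monics n))%:R =
  \sum_(1 <= m < n.+1) (count P (monics (n - m)))%:R * factor_sum G (-1) m.
Proof.
apply: count_logder => [f g /monic_neq0 f0 /andP[/(factors_inP G f0) + _]|g m ig Gg].
  exact.
rewrite big_seq_cond [RHS]big_seq_cond big_mkcond [RHS]big_mkcond.
apply: eq_bigr => h _.
rewrite mem_monics; case: (boolP (h \is monic)) => //= mh; have h0 := monic_neq0 mh.
rewrite /P factors_in_irredM // Gg squarefree_irredM // mult_irredM // eqxx.
case: eqP => //= _; case: factors_in => //=.
case: (boolP (squarefree h)) => //= /(squarefreeP h0)/(_ g ig).
have := mult_gt0 ig h0; case: (g %| h) => /=.
  by case: (mult g h) => [|[|]] //= _ _; rewrite mulr1 subrr.
by case: (mult g h) => //= _ _; rewrite mulr0 addr0.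
Qed.

(** With [k = m %/ deg g], this is [(-1) ^+ k.-1 = 1 - 2 * (2 %| k)]; and [2]
    divides [k] if and only if [deg g] divides [m %/ 2]. *)
Lemma factor_sum_squarefree G m : factor_sum G (-1) m =
  factor_sum G 1 m - (if (2 %| m)%N then 2%:R * factor_sum G 1 (m %/ 2) else 0).
Proof.
have [->|m0] := posnP m.
  rewrite dvdn0 div0n /factor_sum big_seq_cond [X in _ - 2%:R * X]big_seq_cond.
  rewrite [in X in X - _]big_seq_cond !big_pred0 ?mulr0 ?subr0 // => g;
  by rewrite mem_irreds; case: (boolP (irred g)) => //= /irred_deg_gt0; case: deg.
have -> : (if (2 %| m)%N then 2%:R * factor_sum G 1 (m %/ 2) else 0) =
  \sum_(g <- irreds m | G g && (deg g %| m)%N)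
    (if (2 %| m)%N && (deg g %| m %/ 2)%N then 2%:R * (deg g)%:R else 0) :> rat.
  case: (boolP (2 %| m)%N) => m2 /=; last by rewrite big1.
  rewrite -big_mkcondr /= mulr_sumr -[LHS]big_filter -[RHS]big_filter.
  under eq_bigr => g _ do rewrite expr1n mulr1.
  apply: perm_big; apply: uniq_perm; [exact/filter_uniq/uniq_irreds..|].
  move=> g; rewrite [LHS]mem_filter [RHS]mem_filter !mem_irreds.
  case: (irred g); rewrite ?andbF //=.
  case: (G g) => //=; rewrite andbAC; case: (boolP (deg g %| m %/ 2)%N) => gm.
    have gm' : (deg g %| m)%N by rewrite -(divnK m2) dvdn_mulr.
    have m20 : (0 < m %/ 2)%N by rewrite divn_gt0 // dvdn_leq.
    by rewrite gm' (dvdn_leq m0 gm') (dvdn_leq m20 gm).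
  by rewrite andbF.
rewrite -sumrB [LHS]big_seq_cond [RHS]big_seq_cond. apply: eq_bigr => g.
rewrite mem_irreds => /andP[/andP[/irred_deg_gt0 d0 _] /andP[_ dm]].
rewrite expr1n mulr1; case/dvdnP: dm m0 => k ->; rewrite muln_gt0 => /andP[k0 _].
rewrite mulnK //.
have -> : (2 %| k * deg g)%N && (deg g %| (k * deg g) %/ 2)%N = (2 %| k)%N.
  apply/andP/idP => [[/dvdnP[a ka]]|/dvdnP[a ->]].
    rewrite ka mulnK // => /dvdnP[b ab]; apply/dvdnP; exists b.
    by apply/eqP; rewrite -(eqn_pmul2r d0) ka ab mulnAC.
  by rewrite mulnAC mulnK // !dvdn_mull.
case: k k0 => // k _; rewrite dvdn2 /= negbK -signr_odd.
by case: (odd k); rewrite /= ?expr1 ?expr0; ring.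
Qed.

Lemma sum_deg_dvd f n : f \is monic -> squarefree f -> (deg f <= n)%N ->
  (\sum_(g <- irreds n | (g %| f)%R) deg g)%N = deg f.
Proof.
move=> mf sf df; have f0 := monic_neq0 mf.
rewrite [RHS](deg_sum_mult mf df) big_mkcond /= big_seq [RHS]big_seq.
apply: eq_bigr => g; rewrite mem_irreds => /andP[ig _].
have := elimT (squarefreeP f0) sf g ig; have := mult_gt0 ig f0.
case: (g %| f); case: (mult g f) => [|[|]] //=; by rewrite mul1n.
Qed.

End MonicPolynomials.

(** * Powers in finite fields *)

Lemma dvdn_mul_divn M N i : (0 < N)%N -> (M %| N)%N ->
  (N %| i * (N %/ M))%N = (M %| i)%N.
Proof.
move=> N0 /dvdnP[c Nc]; rewrite Nc muln_gt0 in N0 *.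
by case/andP: N0 => c0 M0; rewrite mulnK // mulnC dvdn_pmul2r.
Qed.

Section FiniteField.
Variable K : finFieldType.

(** The translation [x |-> x + 1] permutes the field, so the sum of its elements
    is unchanged by adding [#|K|%:R]. *)
Lemma card_finField_natr : #|K|%:R = 0 :> K.
Proof.
have /eqP : \sum_(x : K) (x + 1) = \sum_(x : K) x.
  by rewrite [RHS](reindex_inj (addIr 1)).
by rewrite big_split /= -[X in _ == X]addr0 (inj_eq (addrI _)) sumr_const => /eqP.
Qed.

Lemma card_finField_pred_gt0 : (0 < #|K|.-1)%N.
Proof. by have := card_finNzRing_gt1 K; case: #|_| => [|[]]. Qed.

Lemma expf_card_pred (x : K) : x != 0 -> x ^+ #|K|.-1 = 1.
Proof.
move=> x0; apply: (mulfI x0); rewrite -exprS prednK ?expf_card ?mulr1 //.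
by rewrite ltnW ?card_finNzRing_gt1.
Qed.

(** All the [#|K|.-1] nonzero elements are roots of unity of that order. *)
Lemma finField_prim_root : {z : K | (#|K|.-1).-primitive_root z}.
Proof.
pose rs := enum (predC1 (0 : K)).
have /hasP/sig2W[z _ z_prim] : has (#|K|.-1).-primitive_root rs.
  apply: has_prim_root; [exact: card_finField_pred_gt0| |exact: enum_uniq|].
    apply/allP => x; rewrite mem_enum inE => x0; rewrite unity_rootE.
    by rewrite expf_card_pred.
  by rewrite -(cardC1 (0 : K)) cardE.
by exists z.
Qed.

(** The units form a cyclic group of order [#|K| - 1]: raising to the power [M]
    is onto when [M] is prime to that order, and otherwise its image is the
    subgroup of index [M]. *)
Lemma finField_powerP M (x : K) : prime M -> x != 0 ->
  (exists y, y ^+ M = x) <->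
  ((M %| #|K|.-1)%N -> x ^+ (#|K|.-1 %/ M) = 1).
Proof.
move=> M_pr x0; have N0 := card_finField_pred_gt0; set N := #|K|.-1 in N0 *.
split=> [[y yx] MN|xN].
  rewrite -yx -exprM mulnC divnK // expf_card_pred //.
  by apply: contraNneq x0 => y0; rewrite -yx y0 expr0n; case: M M_pr {MN yx}.
have [z z_prim] := finField_prim_root.
have [i xE] := prim_rootP z_prim (expf_card_pred x0).
have [MN|MN] := boolP (M %| N)%N.
  move/eqP: (xN MN); rewrite xE -exprM -(prim_order_dvd z_prim) -/N.
  rewrite dvdn_mul_divn //.
  by case/dvdnP=> j ->; exists (z ^+ j); rewrite -exprM.
have /eqP co : coprime N M by rewrite coprime_sym prime_coprime.
case: (egcdnP N (prime_gt0 M_pr)) => a b abE _.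
exists (x ^+ a); rewrite -exprM abE gcdnC co exprD expr1 mulnC exprM.
by rewrite expf_card_pred // expr1n mul1r.
Qed.

End FiniteField.

(** * Polynomials modulo which the variable is a power *)

Section PowerModulo.
Variables (F : finFieldType) (M : nat).
Hypothesis coMq : coprime M #|F|.
Implicit Types f g h p a b : {poly F}.

Definition powmod f := exists g, f %| g ^+ M - 'X.

Lemma powmod_dvd f g : g %| f -> powmod f -> powmod g.
Proof. by move=> gf [h fh]; exists h; apply: dvdp_trans fh. Qed.

Lemma dvdp_subX f a b n : f %| a - b -> f %| a ^+ n - b ^+ n.
Proof. by move=> fab; rewrite subrXX dvdp_mulr. Qed.

Lemma powmodM f g : coprimep f g -> powmod f -> powmod g -> powmod (f * g).
Proof.
move=> co [a fa] [b gb]; have /Bezout_eq1_coprimepP[[u v] /= uv] := co.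
pose c := b * u * f + a * v * g; exists c; rewrite Gauss_dvdp //; apply/andP; split.
  have -> : c ^+ M - 'X = (c ^+ M - a ^+ M) + (a ^+ M - 'X) by ring.
  rewrite dvdp_add // dvdp_subX //.
  have -> : c - a = (b - a) * u * f + a * (u * f + v * g - 1) by rewrite /c; ring.
  by rewrite uv subrr mulr0 addr0 dvdp_mull.
have -> : c ^+ M - 'X = (c ^+ M - b ^+ M) + (b ^+ M - 'X) by ring.
rewrite dvdp_add // dvdp_subX //.
have -> : c - b = (a - b) * v * g + b * (u * f + v * g - 1) by rewrite /c; ring.
by rewrite uv subrr mulr0 addr0 dvdp_mull.
Qed.

(** Hensel lifting by Frobenius: with [n] a large power of the characteristic,
    [g ^+ k] divides [r ^+ (M * n) - 'X ^+ n], and the exponent [n], prime to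
    [M], can be brought back to 1 modulo [M]. *)
Lemma powmodX g k : coprimep g 'X -> powmod g -> powmod (g ^+ k).
Proof.
move=> gX [r gr]; have [p p_pr pF] := finPcharP F; pose n := (p ^ k)%N.
have n_gt0 : (0 < n)%N by rewrite expn_gt0 prime_gt0.
have coMn : coprime M n.
  rewrite coprimeXr // (coprime_dvdr _ coMq) // (dvdn_pcharf pF).
  by rewrite card_finField_natr.
have n_p : [pchar {poly F}].-nat n.
  rewrite pnatX; apply/orP; left; rewrite pnatE //.
  by rewrite (pchar_poly F).
have kn : (k <= n)%N by apply/ltnW/ltn_expl/prime_gt1.
have gkr : g ^+ k %| r ^+ M ^+ n - 'X ^+ n.
  have -> : r ^+ M ^+ n - 'X ^+ n = (r ^+ M - 'X) ^+ n.
    by rewrite -[RHS](addrK ('X ^+ n)) -exprDn_pchar // subrK.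
  by rewrite (dvdp_trans (dvdp_exp2l _ kn)) // dvdp_exp2r.
have [a b abE _ /=] := egcdnP M n_gt0.
move: abE; rewrite gcdnC (eqP coMn) => abE.
have /Bezout_eq1_coprimepP[[u v] /= uv] : coprimep (g ^+ k) ('X ^+ b).
  exact/coprimep_expl/coprimep_expr.
(* As [n * a = b * M + 1], the power [M] of [r ^+ (n * a)] is congruent to
   ['X * ('X ^+ b) ^+ M], and [v] is an inverse of ['X ^+ b]. *)
exists (v * r ^+ (n * a)).
have -> : (v * r ^+ (n * a)) ^+ M - 'X =
  v ^+ M * (r ^+ M ^+ n ^+ a - 'X^n ^+ a) + 'X * ((v * 'X^b) ^+ M - 1 ^+ M).
  rewrite expr1n !exprMn -!exprM [(n * a)%N]mulnC abE exprD expr1.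
  by rewrite [((b * M + 1) * M)%N]mulnC; ring.
rewrite dvdp_add // dvdp_mull // dvdp_subX //.
have -> : v * 'X^b - 1 = - (u * g ^+ k) by rewrite -uv; ring.
by rewrite dvdpNr dvdp_mull.
Qed.

(** ['X] is excluded because [f] has to be prime to ['X] to be the annihilator of
    an invertible matrix; modulo ['X] the variable is the power [0 ^+ M]. *)
Definition good g := (g != 'X) && `[< powmod g >].

Lemma irredX : irred ('X : {poly F}).
Proof. by apply/irredP; rewrite monicX -['X]subr0; split=> //; apply: irredp_XsubC. Qed.

(** The prime power factors of [f] are dealt with by [powmodX] and put together by
    [powmodM]. *)
Lemma factors_in_goodP f : f \is monic ->
  factors_in good f <-> ~~ ('X %| f) /\ powmod f.
Proof.
move=> mf; have f0 := monic_neq0 mf; split=> [/(factors_inP _ f0) gf|[Xf pf]].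
  split; first by apply/negP => /(gf _ irredX); rewrite /good eqxx.
  rewrite (monic_factorization mf (leqnn _)).
  have := uniq_irreds F (deg f).
  have : {subset irreds F (deg f) <=
      [pred g | irred g && ((0 < mult g f)%N ==> good g)]}.
    move=> g; rewrite mem_irreds => /andP[ig _]; rewrite inE ig /=.
    by rewrite mult_gt0 //; apply/implyP; apply: gf.
  elim: (irreds F (deg f)) => [_ _|g s IHs sub /= /andP[gs us]].
    by rewrite big_nil; exists 0; rewrite dvd1p.
  rewrite big_cons; have /andP[ig gg] := sub g (mem_head _ _).
  have subs : {subset s <= [pred g | irred g && ((0 < mult g f)%N ==> good g)]}.
    by move=> h hs; apply: sub; rewrite in_cons hs orbT.
  apply: powmodM; last exact: IHs.
    rewrite coprimep_expl // big_seq.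
    apply: (big_rec (fun x => coprimep g x) (coprimep1 _)) => h k hs gk.
    have /andP[ih _] := subs h hs.
    rewrite coprimepMr gk andbT coprimep_expr // irred_coprime // irred_dvd //.
    by apply: contraNneq gs => ->.
  have [->|mg0] := posnP (mult g f); first by exists 0; rewrite dvd1p.
  move: gg; rewrite mg0 => /andP[gX /asboolP pg]; apply: powmodX => //.
  by rewrite irred_coprime // irred_dvd // irredX.
apply/factors_inP => // g ig gf; apply/andP; split.
  by apply: contraNneq Xf => <-.
exact/asboolP/(powmod_dvd gf).
Qed.

End PowerModulo.

(** * The order of the variable modulo an irreducible polynomial *)

Lemma pchar_card_finField (K : finFieldType) : [pchar K].-nat #|K|.
Proof.
have := abelem_pgroup (finField_is_abelem K); rewrite /pgroup cardsT.
move: (pdiv _) => p pK; apply/pnatP; first by rewrite ltnW ?card_finNzRing_gt1.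
move=> r r_pr rK; have -> : r = p.
  by apply/eqP; move/pnatP: pK => /(_ (ltnW (card_finNzRing_gt1 K)) r r_pr rK).
have [n Kn] := p_natP pK; have p_pr : prime p.
  by move/pnatP: pK => /(_ (ltnW (card_finNzRing_gt1 K)) r r_pr rK) /eqnP <-.
have := card_finField_natr K; rewrite Kn natrX => /eqP.
by rewrite expf_eq0 inE p_pr => /andP[].
Qed.

Lemma dvdn_pred_exp q d e : (1 < q)%N -> (0 < d)%N ->
  (q ^ d - 1 %| q ^ e - 1)%N = (d %| e)%N.
Proof.
move=> q1 d0; have q_gt0 n : (0 < q ^ n)%N by rewrite expn_gt0 ltnW.
rewrite -eqn_mod_dvd // {1}(divn_eq e d) expnD mulnC [(_ * d)%N]mulnC expnM.
have qd : (q ^ d = 1 %[mod q ^ d - 1])%N.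
  by apply/eqP; rewrite eqn_mod_dvd.
rewrite -modnMmr -modnXm qd modnXm exp1n modnMmr muln1 eqn_mod_dvd // /dvdn.
have := ltn_pmod e d0; case: (posnP (e %% d)) => [-> _|r0 rd];
  first by rewrite expn0 mod0n.
have : (q ^ (e %% d) < q ^ d)%N by rewrite ltn_exp2l.
have : (q ^ 0 < q ^ (e %% d))%N by rewrite ltn_exp2l.
rewrite expn0 => r1 r2; rewrite modn_small; last by lia.
by rewrite subn_eq0 leqNgt r1; case: (e %% d)%N r0.
Qed.

Lemma in_qpoly_eq0 (R : fieldType) (h p : {poly R}) : h \is monic -> (1 < size h)%N ->
  (in_qpoly h p == 0) = (h %| p).
Proof. by move=> mh sh; rewrite -val_eqE /= /mk_monic sh mh dvdpE. Qed.

Section VariableOrder.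
Variables (F : finFieldType) (g : {poly F}).
Hypothesis gI : monic_irreducible_poly g.
Let K : finFieldType := {poly %/ g with gI}.
Let mg : g \is monic := snd gI.
Let sg : (1 < size g)%N. Proof. by case: (fst gI). Qed.
Let x : K := in_qpoly g 'X.
Local Notation q := #|F|.
Local Notation d := (deg g).

Lemma cardK : #|K| = (q ^ d)%N.
Proof. exact: card_qfpoly. Qed.

Lemma dvd_Xn_sub1 n : (g %| 'X^n - 1) = (x ^+ n == 1).
Proof.
by rewrite -(in_qpoly_eq0 _ mg sg) rmorphB rmorphXn rmorph1 subr_eq0.
Qed.

(** Frobenius powers over [F] are ring morphisms fixing [F], and [x] generates
    the field as an algebra. *)
Lemma frobenius_fixed e (y : K) : x ^+ (q ^ e) = x -> y ^+ (q ^ e) = y.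
Proof.
move=> xe.
have cF (a : F) : a ^+ (q ^ e) = a.
  by elim: e {xe} => [|e IHe]; rewrite ?expn0 ?expr1 // expnS exprM expf_card.
have nK : [pchar {poly %/ g}].-nat (q ^ e)%N.
  rewrite pnatX; apply/orP; left; rewrite (eq_pnat _ (pchar_qpoly g)).
  exact: pchar_card_finField.
have yE : y = in_qpoly g (val y).
  by exact/val_inj/esym/in_qpoly_small/size_mk_monic.
rewrite yE; elim/poly_ind: (val y) => [|p c IHp].
  by rewrite raddf0 expr0n expn_eq0 eqn0Ngt [(0 < q)%N]ltnW ?card_finNzRing_gt1.
rewrite rmorphD rmorphM /= -/x exprDn_pchar // exprMn.
by rewrite IHp xe -rmorphXn /= -polyC_exp cF.
Qed.

Lemma in_qpoly_surj (y : K) : exists p, y = in_qpoly g p.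
Proof.
by exists (val y); exact/val_inj/esym/in_qpoly_small/size_mk_monic.
Qed.

Hypothesis gX : g != 'X.

Lemma qX_neq0 : x != 0.
Proof.
have ig : irred g by apply/irredP; case: gI.
by rewrite (in_qpoly_eq0 _ mg sg) irred_dvd // irredX.
Qed.

(** If [x ^+ (q ^ e) = x] then this power of Frobenius fixes every element, in
    particular a generator of the multiplicative group, whose order is
    [q ^ d - 1]; hence [d] divides [e]. *)
Lemma variable_order : exists o, [/\ (0 < o)%N,
  forall n, (g %| 'X^n - 1) = (o %| n)%N,
  forall e, (o %| q ^ e - 1)%N = (d %| e)%N &
  forall M, prime M ->
    (powmod M g <-> ((M %| q ^ d - 1)%N -> (o %| (q ^ d - 1) %/ M)%N))].
Proof.
have ig : irred g by apply/irredP; case: gI.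
have d0 := irred_deg_gt0 ig; have q1 : (1 < q)%N := card_finNzRing_gt1 F.
have x0 := qX_neq0; have K1 : #|K|.-1 = (q ^ d - 1)%N by rewrite cardK subn1.
have [o o_prim oN] := prim_order_exists (card_finField_pred_gt0 K) (expf_card_pred x0).
have oE n : (g %| 'X^n - 1) = (o %| n)%N.
  by rewrite dvd_Xn_sub1 -(prim_order_dvd o_prim).
exists o; split=> //; first exact: prim_order_gt0 o_prim.
- move=> e; apply/idP/idP => [|de]; last first.
    by apply: dvdn_trans oN _; rewrite K1 dvdn_pred_exp.
  rewrite (prim_order_dvd o_prim) => /eqP xe.
  have {}xe : x ^+ (q ^ e) = x.
    rewrite -[(q ^ e)%N](@subnK 1) ?expn_gt0 1?ltnW // exprD expr1.
    by rewrite -[X in _ = X]mul1r; congr (_ * _).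
  have [z z_prim] := finField_prim_root K.
  have z0 : z != 0.
    apply/eqP => z0; have := prim_expr_order z_prim; rewrite z0 expr0n.
    by rewrite eqn0Ngt card_finField_pred_gt0 => /eqP; rewrite eq_sym oner_eq0.
  have := frobenius_fixed z xe => ze.
  rewrite -(@dvdn_pred_exp q d e) // -K1 (prim_order_dvd z_prim).
  apply/eqP/(mulfI z0); rewrite -exprS mulr1 subn1 prednK //.
  by rewrite expn_gt0 ltnW.
move=> M M_pr; rewrite -K1 (prim_order_dvd o_prim).
apply: iff_trans (iff_trans (finField_powerP M_pr x0) _); last first.
  by split=> xM MK; apply/eqP/xM.
split=> [[p gp]|[y yx]].
  exists (in_qpoly g p); apply/eqP; rewrite -subr_eq0; move: gp.
  by rewrite -(in_qpoly_eq0 _ mg sg) rmorphB rmorphXn.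
have [p yE] := in_qpoly_surj y; exists p.
by rewrite -(in_qpoly_eq0 _ mg sg) rmorphB rmorphXn /= -yE -/x subr_eq0; apply/eqP.
Qed.

End VariableOrder.

(** * Counting the polynomials whose roots are powers *)

Lemma dvdn_geometric_sum M Q c : (M %| Q - 1)%N -> (0 < Q)%N ->
  (M %| \sum_(i < c) Q ^ i)%N = (M %| c)%N.
Proof.
move=> MQ Q0; have Q1 : (Q = 1 %[mod M])%N by apply/eqP; rewrite eqn_mod_dvd.
rewrite /dvdn; congr (_ == 0%N); elim: c => [|c IHc]; first by rewrite big_ord0.
by rewrite big_ord_recr /= -modnDm IHc -modnXm Q1 modnXm exp1n modnDm addn1.
Qed.

Section LevelOfFactor.
Variables (M q t d o m : nat).
Hypotheses (M_pr : prime M) (q_gt1 : (1 < q)%N) (d_gt0 : (0 < d)%N).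
Hypotheses (m_gt0 : (0 < m)%N) (o_gt0 : (0 < o)%N).
Hypothesis M_dvd : forall e, (M %| q ^ e - 1)%N = (t %| e)%N.
Hypothesis o_dvd : forall e, (o %| q ^ e - 1)%N = (d %| e)%N.

(** An element of degree [d] and order [o] is a non-power in its own field
    exactly when [M] does not divide the cofactor of [o] in [q ^ d - 1] while
    [M] divides [q ^ d - 1]; in a larger field of degree [d * c] the cofactor
    gets multiplied by a number congruent to [c] modulo [M], so it remains a
    non-power precisely when [M] does not divide [c]. *)
Lemma level_of_factor k :
  [&& (M ^ k * t %| m)%N, (o %| q ^ (m %/ M ^ k) - 1)%N
    & ~~ (o %| (q ^ (m %/ M ^ k) - 1) %/ M)%N] =
  [&& (M %| q ^ d - 1)%N, ~~ (o %| (q ^ d - 1) %/ M)%N, (d %| m)%N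
    & k == logn M (m %/ d)].
Proof.
have Mk_gt0 : (0 < M ^ k)%N by rewrite expn_gt0 prime_gt0.
have [r qd] : exists r, (q ^ d - 1)%N = (r * o)%N by apply/dvdnP; rewrite o_dvd.
have qE c : (q ^ (d * c) - 1 = r * o * \sum_(i < c) (q ^ d) ^ i)%N.
  by rewrite -qd expnM !subn1 predn_exp.
have cofactor_d : (M %| q ^ d - 1)%N -> (o %| (q ^ d - 1) %/ M)%N = (M %| r)%N.
  by move=> Md; rewrite dvdn_divRL // qd mulnC dvdn_pmul2r.
have cofactor_dc c : (M %| q ^ d - 1)%N ->
    (o %| (q ^ (d * c) - 1) %/ M)%N = (M %| r)%N || (M %| c)%N.
  move=> Md; have Mdc : (M %| q ^ (d * c) - 1)%N by rewrite qE -qd dvdn_mulr.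
  rewrite dvdn_divRL // qE mulnAC mulnC dvdn_pmul2r // Euclid_dvdM //.
  by rewrite dvdn_geometric_sum // expn_gt0 ltnW.
apply/and3P/and4P => [[Mkt]|[Md + dm /eqP kE]].
  rewrite o_dvd => /dvdnP[c eE]; rewrite eE mulnC => oM.
  have Mkm : (M ^ k %| m)%N by apply: dvdn_trans Mkt; apply: dvdn_mulr.
  have mE : m = (d * c * M ^ k)%N by rewrite [(d * c)%N]mulnC -eE divnK.
  have te : (t %| d * c)%N by rewrite -(dvdn_pmul2l Mk_gt0) [X in (_ %| X)%N]mulnC -mE.
  have Md : (M %| q ^ d - 1)%N.
    move: te; rewrite -M_dvd => Mdc; move: oM; rewrite dvdn_divRL //.
    move: (Mdc); rewrite qE -mulnA Euclid_dvdM // => /orP[Mr /negP[]|].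
      by rewrite [(r * _)%N]mulnC -mulnA dvdn_mul // dvdn_mull.
    rewrite Euclid_dvdM // => /orP[Mo _|MS /negP[]].
      by rewrite qd dvdn_mull.
    by rewrite dvdn_mull // dvdn_mul.
  move: oM; rewrite cofactor_dc // negb_or => /andP[Mr Mc].
  have c0 : (0 < c)%N by case: c Mc {mE eE te}; rewrite ?dvdn0.
  rewrite Md cofactor_d // Mr mE -mulnA dvdn_mulr // mulKn //.
  by rewrite lognM // pfactorK // logn_coprime ?add0n ?prime_coprime ?eqxx.
rewrite cofactor_d // => Mr.
have md0 : (0 < m %/ d)%N by rewrite divn_gt0 // dvdn_leq.
have [c coMc mdE] := pfactor_coprime M_pr md0; rewrite -kE in mdE.
have mE : m = (d * c * M ^ k)%N by rewrite -mulnA -mdE mulnC divnK.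
rewrite mE mulnK // cofactor_dc // negb_or Mr -prime_coprime //.
rewrite mulnC dvdn_pmul2r // o_dvd coMc.
by split; rewrite // dvdn_mulr // -M_dvd.
Qed.

End LevelOfFactor.

Section FactorSum.
Variables (F : finFieldType) (M t : nat).
Hypotheses (M_pr : prime M) (t_gt0 : (0 < t)%N).
Local Notation q := #|F|.
Hypothesis M_dvd : forall e, (M %| q ^ e - 1)%N = (t %| e)%N.

Lemma irred_mi (g : {poly F}) : irred g -> monic_irreducible_poly g.
Proof. by case/irredP. Qed.

Lemma X_dvd_Xn_sub1 n : (0 < n)%N -> (('X : {poly F}) %| 'X^n - 1) = false.
Proof.
case: n => // n _; rewrite dvdp_subr; last by rewrite exprS dvdp_mulr.
by apply/negbTE; rewrite -irred_coprime ?irredX // coprimep1.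
Qed.

(** A divisor of [q ^ e - 1] is invertible in [F], so the polynomial is
    separable. *)
Lemma squarefree_Xn_sub1 n e : (0 < n)%N -> (n %| q ^ e - 1)%N -> (0 < e)%N ->
  squarefree ('X^n - 1 : {poly F}).
Proof.
move=> n0 nq e0; have f0 : 'X^n - 1 != 0 :> {poly F}.
  by rewrite monic_neq0 ?monic_Xn_sub_1.
apply/allP => g; rewrite mem_irreds => /andP[ig _].
have sg : size g != 1%N by case/irredP: ig => -[] + _; case: size => [|[]].
rewrite separable_nosquare // separable_Xn_sub_1 //.
apply/eqP => nF; have q0 : (q ^ e)%:R = 0 :> F.
  by rewrite natrX card_finField_natr expr0n; case: e e0 {nq}.
have /dvdnP[r qE] := nq.
have : (q ^ e)%:R = 1 :> F.
  rewrite -(subnK (_ : 1 <= q ^ e)%N) ?expn_gt0 1?ltnW ?card_finNzRing_gt1 //.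
  by rewrite qE natrD natrM nF mulr0 add0r.
by rewrite q0 => /eqP; rewrite eq_sym oner_eq0.
Qed.

Lemma sum_deg_Xn_sub1 N n e : (0 < n)%N -> (n %| q ^ e - 1)%N -> (0 < e)%N ->
  (n <= N)%N ->
  \sum_(g <- irreds F N) (g %| 'X^n - 1)%R%:R * (deg g)%:R = n%:R :> rat.
Proof.
move=> n0 nq e0 nN; have dn : deg ('X^n - 1 : {poly F}) = n.
  by rewrite /deg size_Xn_sub_1.
rewrite -[in RHS]dn -(@sum_deg_dvd _ _ N) ?dn ?monic_Xn_sub_1 //; last first.
  exact: squarefree_Xn_sub1 nq e0.
rewrite natr_sum [RHS]big_mkcond; apply: eq_bigr => g _.
by case: ifP; rewrite ?mul1r ?mul0r.
Qed.

(** The [k]-th term tells whether the roots of [g] lie in the field of degree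
    [m %/ M ^ k] without being [M]-th powers there. If [g] is not good and its
    degree divides [m], this happens for one single [k]; otherwise it never
    does. *)
Lemma good_indicator (g : {poly F}) m : irred g -> (0 < m)%N ->
  (good M g && (deg g %| m)%N)%:R =
  (g %| 'X^(q ^ m - 1) - 1)%R%:R - \sum_(k < m.+1 | (M ^ k * t %| m)%N)
    ((g %| 'X^(q ^ (m %/ M ^ k) - 1) - 1)%R%:R
      - (g %| 'X^((q ^ (m %/ M ^ k) - 1) %/ M) - 1)%R%:R) :> rat.
Proof.
move=> ig m0; have q1 : (1 < q)%N := card_finNzRing_gt1 F.
have e_gt0 k : (M ^ k * t %| m)%N -> (0 < m %/ M ^ k)%N.
  by move/(dvdn_leq m0) => km; rewrite divn_gt0 ?expn_gt0 ?prime_gt0 //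
    (leq_trans _ km) // leq_pmulr.
have q_gt0 e : (0 < e)%N -> (0 < q ^ e - 1)%N.
  by move=> e0; rewrite subn_gt0 -(expn0 q) ltn_exp2l.
have M_dvd_e k : (M ^ k * t %| m)%N -> (M %| q ^ (m %/ M ^ k) - 1)%N.
  move=> kt; rewrite M_dvd -(@dvdn_pmul2l (M ^ k)) ?expn_gt0 ?prime_gt0 //.
  rewrite [X in (_ %| X)%N]mulnC divnK //.
  by apply: dvdn_trans kt; apply: dvdn_mulr.
have [->|gX] := eqVneq g 'X.
  rewrite /good eqxx /= X_dvd_Xn_sub1 ?q_gt0 // big1 ?subr0 // => k kt.
  rewrite !X_dvd_Xn_sub1 ?subr0 ?q_gt0 ?e_gt0 //.
  by rewrite divn_gt0 ?prime_gt0 // dvdn_leq ?q_gt0 ?e_gt0 ?M_dvd_e.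
have [o [o0 gN oq gM]] := variable_order (irred_mi ig) gX.
have d0 := irred_deg_gt0 ig.
rewrite gN oq.
transitivity ((deg g %| m)%:R - \sum_(k < m.+1)
  [&& (M %| q ^ deg g - 1)%N, ~~ (o %| (q ^ deg g - 1) %/ M)%N, (deg g %| m)%N
    & k == logn M (m %/ deg g) :> nat]%:R : rat).
  rewrite /good gX /=; have -> : `[< powmod M g >] =
      ~~ ((M %| q ^ deg g - 1)%N && ~~ (o %| (q ^ deg g - 1) %/ M)%N).
    rewrite negb_and negbK -implybE.
    by apply/asboolP/implyP; [move/(gM M M_pr)|move=> ?; apply/(gM M M_pr)].
  case: (boolP (M %| _)%N) => /= _; last by rewrite big1 ?subr0.
  case: (boolP (o %| _)%N) => /= _; first by rewrite big1 ?subr0.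
  case: (boolP (deg g %| m)%N) => /= dm; last by rewrite big1 ?subr0.
  have vm : (logn M (m %/ deg g) < m.+1)%N.
    rewrite ltnS (leq_trans (ltnW (ltn_expl _ (prime_gt1 M_pr)))) //.
    have md0 : (0 < m %/ deg g)%N by rewrite divn_gt0 // dvdn_leq.
    apply: leq_trans (leq_div m (deg g)).
    by rewrite dvdn_leq // pfactor_dvdn.
  rewrite (bigD1 (Ordinal vm)) //= eqxx big1 ?addr0 ?subrr //.
  by move=> k; rewrite -val_eqE /= => /negPf ->.
congr (_ - _); rewrite [RHS]big_mkcond; apply: eq_bigr => k _.
rewrite -(level_of_factor M_pr q1 d0 m0 o0 M_dvd oq) !gN.
case: (boolP (_ * _ %| _)%N) => //= kt.
case: (boolP (o %| q ^ _ - 1)%N) => /= oe; last first.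
  suff /negPf -> : ~~ (o %| (q ^ (m %/ M ^ k) - 1) %/ M)%N by rewrite subrr.
  apply: contra oe => /dvdn_trans; apply.
  by rewrite -{2}(divnK (M_dvd_e k kt)) dvdn_mulr.
by case: (o %| _)%N; rewrite ?subrr ?subr0.
Qed.

(** The indicators of [good_indicator] are summed with weight [deg g]: since
    ['X^N - 1] is squarefree, the degrees of its irreducible factors add up to
    [N]. *)
Lemma factor_sum_goodE m : (0 < m)%N ->
  factor_sum (good M : pred {poly F}) 1 m = (q ^ m - 1)%:R +
    \sum_(k < m.+1) (1 - M%:R) / M%:R *
      (if (M ^ k * t %| m)%N then (q ^ (m %/ M ^ k) - 1)%:R else 0).
Proof.
move=> m0; have q1 : (1 < q)%N := card_finNzRing_gt1 F.
(* All the sums are taken over the irreducible polynomials of degree at most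
   [N], a bound large enough for the factors of the polynomials ['X^i - 1]. *)
pose N := (q ^ m)%N; have mN : (m <= N)%N by apply/ltnW/ltn_expl.
transitivity (\sum_(g <- irreds F N)
  (good M g && (deg g %| m)%N)%:R * (deg g)%:R : rat).
  rewrite (eq_bigr (fun g => if good M g && (deg g %| m)%N then (deg g)%:R else 0));
    last by move=> g _; case: (_ && _); rewrite ?mul1r ?mul0r.
  rewrite -big_mkcond -[LHS]big_filter -[RHS]big_filter.
  under eq_bigr => g _ do rewrite expr1n mulr1.
  apply: perm_big; apply: uniq_perm; [exact/filter_uniq/uniq_irreds..|].
  move=> g; rewrite [LHS]mem_filter [RHS]mem_filter !mem_irreds.
  case: (irred g); rewrite ?andbF //=; case: (good M g) => //=.
  case: (boolP (_ %| _)%N) => //= /(dvdn_leq m0) gm.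
  by rewrite gm (leq_trans gm).
pose ind n (g : {poly F}) : rat := (g %| 'X^n - 1)%R%:R * (deg g)%:R.
transitivity (\sum_(g <- irreds F N) (ind (q ^ m - 1)%N g -
  \sum_(k < m.+1 | (M ^ k * t %| m)%N)
    (ind (q ^ (m %/ M ^ k) - 1)%N g - ind ((q ^ (m %/ M ^ k) - 1) %/ M)%N g))).
  rewrite big_seq [RHS]big_seq; apply: eq_bigr => g; rewrite mem_irreds => /andP[ig _].
  rewrite good_indicator // mulrBl mulr_suml; congr (_ - _).
  by apply: eq_bigr => k _; rewrite mulrBl.
have q_gt0 e : (0 < e)%N -> (0 < q ^ e - 1)%N.
  by move=> e0; rewrite subn_gt0 -(expn0 q) ltn_exp2l.
rewrite sumrB exchange_big /= (sum_deg_Xn_sub1 _ (dvdnn _)) ?q_gt0 ?leq_subr //.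
congr (_ + _); rewrite -sumrN big_mkcond; apply: eq_bigr => k _.
case: ifP => kt; last by rewrite mulr0.
have e_gt0 : (0 < m %/ M ^ k)%N.
  rewrite divn_gt0 ?expn_gt0 ?prime_gt0 // (leq_trans _ (dvdn_leq m0 kt)) //.
  by rewrite leq_pmulr.
have Me : (M %| q ^ (m %/ M ^ k) - 1)%N.
  rewrite M_dvd -(@dvdn_pmul2l (M ^ k)) ?expn_gt0 ?prime_gt0 //.
  rewrite [X in (_ %| X)%N]mulnC divnK //.
  by apply: dvdn_trans kt; apply: dvdn_mulr.
have eN : (q ^ (m %/ M ^ k) - 1 <= N)%N.
  by rewrite (leq_trans (leq_subr _ _)) // leq_exp2l // leq_div.
rewrite sumrB (sum_deg_Xn_sub1 _ (dvdnn _)) ?q_gt0 //.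
rewrite (@sum_deg_Xn_sub1 _ _ (m %/ M ^ k)) //.
- have M0 : M%:R != 0 :> rat by rewrite Num.Theory.pnatr_eq0 -lt0n prime_gt0.
  rewrite -[in X in X%:R - _](divnK Me) -[in RHS](divnK Me) natrM.
  by move: (_ %/ M)%N%:R => a; field.
- by rewrite divn_gt0 ?prime_gt0 // dvdn_leq ?q_gt0.
- by rewrite -{2}(divnK Me) dvdn_mulr.
by rewrite (leq_trans (leq_div _ _)).
Qed.

End FactorSum.

(** * Cyclic matrices *)

Section CyclicMatrices.
Variables (F : finFieldType) (n' : nat).
Local Notation n := n'.+1.
Implicit Types (A B : 'M[F]_n) (f g p r : {poly F}) (v w : 'cV[F]_n).

(** [f] generates the annihilator of [v]; when [deg f = n], this forces [v] to
    generate the whole space under [A]. *)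
Definition cyclic_vector A f v := forall p, (horner_mx A p *m v == 0) = (f %| p).
Definition cyclic_mx A f := exists v, cyclic_vector A f v.

(** The vector with coordinates [u] on [v, A v, A^2 v, ...]. *)
Definition krylov_row A v (u : 'rV[F]_n) : 'rV[F]_n := (horner_mx A (rVpoly u) *m v)^T.

Fact krylov_row_linear A v : linear (krylov_row A v).
Proof.
move=> a x y; rewrite /krylov_row linearP /= rmorphD /= -mul_polyC rmorphM /=.
by rewrite horner_mx_C mulmxDl -mulmxA mul_scalar_mx linearP.
Qed.
HB.instance Definition _ A v :=
  GRing.isLinear.Build F 'rV[F]_n 'rV[F]_n *:%R (krylov_row A v)
    (krylov_row_linear A v).

Definition krylov_mx A v : 'M[F]_n := lin1_mx (krylov_row A v).

Lemma mul_krylov_mx A v u : u *m krylov_mx A v = (horner_mx A (rVpoly u) *m v)^T.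
Proof. by rewrite mul_rV_lin1. Qed.

Definition mulX_row f (u : 'rV[F]_n) : 'rV[F]_n := poly_rV (('X * rVpoly u) %% f).

Fact mulX_row_linear f : linear (mulX_row f).
Proof.
move=> a x y; rewrite /mulX_row linearP /= mulrDr -scalerAr modpD modpZl.
by rewrite linearP.
Qed.
HB.instance Definition _ f :=
  GRing.isLinear.Build F 'rV[F]_n 'rV[F]_n *:%R (mulX_row f) (mulX_row_linear f).

(** Multiplication by [X] on [F[X]/(f)], acting on row vectors. *)
Definition mulX_mx f : 'M[F]_n := lin1_mx (mulX_row f).

Lemma mul_mulX_mx f u : u *m mulX_mx f = poly_rV (('X * rVpoly u) %% f).
Proof. by rewrite mul_rV_lin1. Qed.

Lemma mulmx_col0 B : (forall w, B *m w = 0) -> B = 0.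
Proof.
move=> B0; apply/matrixP => i j.
by have := congr1 (fun C : 'cV_n => C i 0) (B0 (delta_mx j 0)); rewrite -colE !mxE.
Qed.

Section Fixed.
Variable f : {poly F}.
Hypotheses (mf : f \is monic) (df : deg f = n).

Lemma size_modp_deg p : (size (p %% f)%R <= n)%N.
Proof.
have f0 := monic_neq0 mf; have := ltn_modp p f.
by rewrite f0 (size_deg f0) df ltnS.
Qed.

Lemma cyclic_vector_mod A v p : cyclic_vector A f v ->
  horner_mx A (p %% f) *m v = horner_mx A p *m v.
Proof.
move=> fv; apply/eqP; rewrite -subr_eq0 -mulmxBl -rmorphB fv.
by rewrite {2}(divp_eq p f) opprD addrC addrNK -mulNr dvdp_mull.
Qed.

Lemma krylov_unit A v : cyclic_vector A f v -> krylov_mx A v \in unitmx.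
Proof.
move=> fv; rewrite -row_free_unit; apply: inj_row_free => u.
rewrite mul_krylov_mx => /(congr1 trmx); rewrite trmxK trmx0 => /eqP.
rewrite fv => fu; apply/(can_inj rVpolyK); rewrite linear0.
apply: contraTeq fu => u0; apply/negP => /(dvdp_leq u0).
by rewrite leqNgt (size_deg (monic_neq0 mf)) df ltnS size_poly.
Qed.

(** The coordinates of [w] on the basis [v, A v, A^2 v, ...], as a polynomial. *)
Definition krylov_poly A v w : {poly F} := rVpoly (w^T *m invmx (krylov_mx A v)).

Lemma krylov_polyK A v w : cyclic_vector A f v ->
  horner_mx A (krylov_poly A v w) *m v = w.
Proof.
move=> fv; apply: trmx_inj; rewrite -mul_krylov_mx mulmxKV //.
exact: krylov_unit.
Qed.

Lemma cyclic_vector_horner_eq0 A v p : cyclic_vector A f v ->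
  (horner_mx A p == 0) = (f %| p).
Proof.
move=> fv; apply/eqP/idP => [pA|fp]; first by rewrite -fv pA mul0mx.
apply: mulmx_col0 => w; rewrite -(krylov_polyK w fv) mulmxA.
set r := krylov_poly _ _ _.
have -> : horner_mx A p *m horner_mx A r = horner_mx A r *m horner_mx A p.
  exact: comm_horner_mx2.
by rewrite -mulmxA (eqP (etrans (fv p) fp)) mulmx0.
Qed.

(** [B] is determined by the image of a cyclic vector, which some polynomial in
    [A] also attains. *)
Lemma cyclic_commutant A B : cyclic_mx A f -> B *m A = A *m B ->
  exists g, B = horner_mx A g.
Proof.
move=> [v fv] BA; pose g := krylov_poly A v (B *m v); exists g.
apply/eqP; rewrite -subr_eq0; apply/eqP/mulmx_col0 => w; set D := B - _.
rewrite -(krylov_polyK w fv); set r := krylov_poly _ _ _.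
have Dr : D *m horner_mx A r = horner_mx A r *m D.
  rewrite mulmxBl mulmxBr; congr (_ - _); last exact: comm_horner_mx2.
  exact/esym/comm_horner_mx/esym.
by rewrite mulmxA Dr -mulmxA mulmxBl (krylov_polyK _ fv) subrr mulmx0.
Qed.

(** A root of [A] commutes with [A], hence is a polynomial in [A]. *)
Lemma cyclic_mx_powerP M A : (0 < M)%N -> cyclic_mx A f ->
  (exists B, B ^+ M = A) <-> powmod M f.
Proof.
move=> M0 fA; have [v fv] := fA; split=> [[B BM]|[g fg]].
  have [g Bg] : exists g, B = horner_mx A g.
    by apply: (cyclic_commutant fA); rewrite -BM -[B *m _]exprS -[_ *m B]exprSr.
  exists g; rewrite -(cyclic_vector_horner_eq0 _ fv) rmorphB rmorphXn /= -Bg BM.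
  by rewrite horner_mx_X subrr.
exists (horner_mx A g); apply/eqP; rewrite -subr_eq0 -{2}(horner_mx_X A).
by rewrite -rmorphXn -rmorphB (cyclic_vector_horner_eq0 _ fv).
Qed.

Lemma cyclic_mx_unit A : cyclic_mx A f -> (A \in unitmx) = ~~ ('X %| f).
Proof.
move=> [v fv]; have f0 := monic_neq0 mf; apply/idP/negP => [uA Xf|Xf].
  have fX : f = 'X * (f %/ 'X) by rewrite mulrC divpK.
  have h0 : f %/ 'X != 0 by apply: contraNneq f0 => h0; rewrite fX h0 mulr0.
  have : f %| f %/ 'X.
    rewrite -fv; have := fv f; rewrite dvdpp {1}fX rmorphM /= horner_mx_X.
    by rewrite -mulmxA => /eqP /(canRL (mulKmx uA)) ->; rewrite mulmx0.
  move/(dvdp_leq h0); rewrite {1}fX size_mul ?polyX_eq0 // size_polyX /=.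
  by rewrite ltnn.
rewrite -unitmx_tr -row_free_unit; apply: inj_row_free => u uA.
have Au : A *m u^T = 0 by apply: trmx_inj; rewrite trmx_mul trmxK trmx0.
rewrite -[u]trmxK -(krylov_polyK u^T fv); set r := krylov_poly _ _ _.
have : f %| 'X * r.
  by rewrite -fv rmorphM /= horner_mx_X -mulmxA krylov_polyK // Au.
rewrite Gauss_dvdpr; last by rewrite coprimep_sym irred_coprime ?irredX //; apply/negP.
by rewrite -fv => /eqP ->; rewrite trmx0.
Qed.

Lemma cyclic_mx_conj A T : T \in unitmx -> cyclic_mx A f ->
  cyclic_mx (T *m A *m invmx T) f.
Proof.
move=> uT [v fv]; exists (T *m v) => p.
have -> : horner_mx (T *m A *m invmx T) p = T *m horner_mx A p *m invmx T.
  by rewrite horner_mx_uconj.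
rewrite !mulmxA mulmxKV // -mulmxA -fv.
apply/eqP/eqP => [/(canRL (mulKmx uT))->|->]; by rewrite mulmx0.
Qed.

(** In the basis [v, A v, A^2 v, ...] the matrix [A] becomes multiplication by [X]
    modulo [f], which only depends on [f]. *)
Lemma cyclic_vector_mulX A v : cyclic_vector A f v ->
  krylov_mx A v *m A^T = mulX_mx f *m krylov_mx A v.
Proof.
move=> fv; apply/row_matrixP => i; rewrite !rowE !mulmxA; set u := delta_mx 0 i.
rewrite mul_mulX_mx !mul_krylov_mx poly_rV_K ?size_modp_deg //.
by rewrite cyclic_vector_mod // -trmx_mul rmorphM /= horner_mx_X mulmxA.
Qed.

Lemma cyclic_mx_similar A B : cyclic_mx A f -> cyclic_mx B f ->
  exists2 T, T \in unitmx & B = T *m A *m invmx T.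
Proof.
move=> [v fv] [w fw].
have [uP uQ] := (krylov_unit fv, krylov_unit fw).
pose T := (invmx (krylov_mx A v) *m krylov_mx B w)^T.
have uT : T \in unitmx by rewrite unitmx_tr unitmx_mul unitmx_inv uP.
exists T => //; apply: (canRL (mulmxK uT)); apply: trmx_inj.
rewrite !trmx_mul trmxK.
rewrite -mulmxA (cyclic_vector_mulX fw) !mulmxA; congr (_ *m _).
apply: (canLR (mulKmx uP)); rewrite mulmxA cyclic_vector_mulX //.
by rewrite -mulmxA mulmxV // mulmx1.
Qed.

Lemma mulX_mx_horner p r : (size r <= n)%N ->
  poly_rV r *m horner_mx (mulX_mx f) p = poly_rV ((p * r) %% f).
Proof.
elim/poly_ind: p r => [|p c IHp] r sr.
  by rewrite rmorph0 mulmx0 mul0r mod0p linear0.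
rewrite rmorphD rmorphM /= horner_mx_X horner_mx_C mulmxDr mul_mx_scalar.
have -> : horner_mx (mulX_mx f) p * mulX_mx f = mulX_mx f *m horner_mx (mulX_mx f) p.
  exact/esym/comm_mx_horner.
rewrite mulmxA mul_mulX_mx poly_rV_K // IHp ?size_modp_deg //.
rewrite -linearZ -linearD /=; congr poly_rV.
rewrite mulrDl modpD modp_mul mulrA mul_polyC modpZl [r %% f]modp_small //.
by rewrite (size_deg (monic_neq0 mf)) df ltnS.
Qed.

Lemma cyclic_mulX_mx : cyclic_mx (mulX_mx f)^T f.
Proof.
exists (poly_rV 1)^T => p.
have -> : horner_mx (mulX_mx f)^T p = (horner_mx (mulX_mx f) p)^T.
  elim/poly_ind: p => [|p c IHp]; first by rewrite !rmorph0 trmx0.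
  rewrite !rmorphD !rmorphM /= !horner_mx_X !horner_mx_C IHp linearD /=.
  rewrite tr_scalar_mx -[_^T * _]trmx_mul; congr (_^T + _).
  exact/comm_mx_horner.
rewrite -trmx_mul -(inj_eq trmx_inj) trmxK trmx0 mulX_mx_horner ?size_poly1 //.
rewrite mulr1 -(inj_eq (can_inj (@rVpolyK _ _))) poly_rV_K ?size_modp_deg //.
by rewrite linear0.
Qed.

End Fixed.

Lemma cyclic_mx_inj A f g : f \is monic -> deg f = n -> g \is monic -> deg g = n ->
  cyclic_mx A f -> cyclic_mx A g -> f = g.
Proof.
move=> mf df mg dg [v fv] [w gw]; apply/eqP; rewrite -eqp_monic //; apply/andP.
rewrite -(cyclic_vector_horner_eq0 mf df g fv) (cyclic_vector_horner_eq0 mg dg g gw).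
rewrite -(cyclic_vector_horner_eq0 mg dg f gw) (cyclic_vector_horner_eq0 mf df f fv).
by rewrite !dvdpp.
Qed.

End CyclicMatrices.

(** * Combinatorial data of cyclic matrices *)

Section CombinatorialDataOfCyclic.
Variables (F : finFieldType) (n' : nat).
Local Notation n := n'.+1.
Implicit Types (A B : 'M[F]_n) (f g h p r : {poly F}) (v w : 'cV[F]_n).

(** The element [1] of the direct sum corresponds to a cyclic vector. *)
Lemma module_iso_cyclic A (s : seq {poly F}) f :
    {in s, forall r, r \is monic /\ (1 < size r)%N} ->
    (forall p, (f %| p) = all (fun r => r %| p) s) ->
  module_iso A s -> cyclic_mx A f.
Proof.
move=> s_mon fE [phi [[psi phiK psiK] phi_lin phi_X]].
have phi0 j : phi 0 j = 0.
  have := phi_lin j 1 0 0; rewrite !scale1r addr0 => /eqP.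
  by rewrite -subr_eq0 opprD addrA subrr sub0r oppr_eq0 => /eqP.
pose w := psi [ffun=> 1]; have phiw j : phi w j = 1 by rewrite psiK ffunE.
have phip p j : phi (horner_mx A p *m w) j = in_qpoly s`_j p.
  elim/poly_ind: p => [|p c IHp]; first by rewrite rmorph0 mul0mx phi0 raddf0.
  rewrite addrC [p * 'X]mulrC !rmorphD !rmorphM /= horner_mx_X horner_mx_C.
  rewrite mulmxDl mul_scalar_mx phi_lin -mulmxA phi_X IHp phiw.
  congr (_ + _); rewrite -[c%:P]alg_polyC linearZ /= in_qpoly1. by [].
exists w => p; rewrite fE; apply/eqP/allP => [pw r rs|ps].
  have js : (index r s < size s)%N by rewrite index_mem.
  have [mr sr] := s_mon r rs.
  have := phip p (Ordinal js); rewrite pw phi0 /= nth_index // => /esym/eqP.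
  by rewrite in_qpoly_eq0.
apply: (can_inj phiK); apply/ffunP => j; rewrite phip phi0.
have sj : s`_j \in s by apply: mem_nth.
have [mr sr] := s_mon _ sj; apply/eqP; rewrite in_qpoly_eq0 //.
exact: ps.
Qed.

Lemma sum_deg_prod (s : seq {poly F}) : {in s, forall r, r \is monic} ->
  deg (\prod_(r <- s) r) = (\sum_(r <- s) deg r)%N.
Proof.
elim: s => [|r s IHs] sm; first by rewrite !big_nil /deg size_poly1.
have sm' : {in s, forall r, r \is monic}.
  by move=> h hs; apply: sm; rewrite in_cons hs orbT.
rewrite !big_cons degM ?IHs //; first exact/monic_neq0/sm/mem_head.
rewrite big_seq; apply/monic_neq0/monic_prod => h; exact: sm'.
Qed.

(** A vector [p(A) w], with [w] cyclic, is sent to the residues of [p]. This is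
    injective, hence bijective as both sides have [#|F| ^ n] elements. *)
Lemma cyclic_module_iso A (s : seq {poly F}) (f := \prod_(r <- s) r) :
    {in s, forall r, r \is monic /\ (1 < size r)%N} ->
    (forall p, (f %| p) = all (fun r => r %| p) s) -> deg f = n ->
  cyclic_mx A f -> module_iso A s.
Proof.
move=> s_mon fE df [w fw].
have sm : {in s, forall r, r \is monic} by move=> r /s_mon[].
have mf : f \is monic by rewrite /f big_seq; apply: monic_prod => r; apply: sm.
have s_dvd (j : 'I_(size s)) p : f %| p -> s`_j %| p.
  by rewrite fE => /allP; apply; apply: mem_nth.
have eq0 (j : 'I_(size s)) p : (in_qpoly s`_j p == 0) = (s`_j %| p).
  by have [mr sr] := s_mon s`_j (mem_nth 0 (ltn_ord j)); apply: in_qpoly_eq0.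
pose P := krylov_poly A w.
have PK v : horner_mx A (P v) *m w = v by apply: (krylov_polyK mf df _ fw).
pose phi v : {dffun forall j : 'I_(size s), {poly %/ s`_j}} :=
  [ffun j : 'I_(size s) => in_qpoly s`_j (P v)].
have phi_eq v p j : horner_mx A p *m w = v -> phi v j = in_qpoly s`_j p.
  move=> pv; rewrite ffunE; apply/eqP; rewrite -subr_eq0 -raddfB /= eq0.
  by apply: s_dvd; rewrite -fw rmorphB mulmxBl PK pv subrr.
exists phi; split.
- apply: inj_card_bij => [v v' vv'|]; last first.
    rewrite card_dep_ffun card_mx muln1 -df /f sum_deg_prod //.
    rewrite foldrE big_image /= (big_nth 0) big_mkord expn_sum.
    rewrite leq_eqVlt; apply/orP; left; apply/eqP/eq_bigr => j _.
    have [mr sr] := s_mon s`_j (mem_nth 0 (ltn_ord j)).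
    exact: card_monic_qpoly.
  rewrite -(PK v) -(PK v'); apply/eqP; rewrite -subr_eq0 -mulmxBl -rmorphB fw fE.
  apply/(all_nthP 0) => i si; rewrite -(eq0 (Ordinal si)) raddfB subr_eq0.
  by have /ffunP/(_ (Ordinal si)) := vv'; rewrite !ffunE => /eqP.
- move=> j a u v; rewrite (phi_eq u (P u)) ?PK // (phi_eq v (P v)) ?PK //.
  rewrite -in_qpolyZ -in_qpolyD; apply: phi_eq.
  rewrite rmorphD /= -mul_polyC rmorphM /= horner_mx_C.
  by rewrite mulmxDl -mulmxA !PK mul_scalar_mx.
move=> v j; rewrite (phi_eq v (P v)) ?PK // -in_qpolyM; apply: phi_eq.
by rewrite rmorphM /= horner_mx_X -mulmxA PK.
Qed.

Lemma irred_exp_monic g k : irred g -> (0 < k)%N ->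
  g ^+ k \is monic /\ (1 < size (g ^+ k))%N.
Proof.
move=> ig k0; split; first by rewrite monic_exp ?irred_monic.
by apply: leq_ltn_trans (size_exp_irred k ig).
Qed.

Implicit Type e : seq ({poly F} * nat).

Lemma dvdp_prod_irred_exp e p : uniq [seq gk.1 | gk <- e] ->
    {in e, forall gk, irred gk.1} ->
  (\prod_(gk <- e) gk.1 ^+ gk.2 %| p) = all (fun gk => gk.1 ^+ gk.2 %| p) e.
Proof.
elim: e => [|[g k] e IHe] /=; first by rewrite big_nil dvd1p.
case/andP=> ge ue ie; rewrite big_cons -IHe //; last first.
  by move=> gk gke; apply: ie; rewrite in_cons gke orbT.
rewrite Gauss_dvdp // coprimep_expl //= big_seq.
apply: (big_rec (fun x => coprimep g x) (coprimep1 _)) => -[h l] a he ga.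
have [ig ih] := (ie _ (mem_head _ _), ie (h, l) (mem_behead (s := (g, k) :: e) he)).
rewrite coprimepMr ga andbT coprimep_expr //= irred_coprime // irred_dvd //.
by apply: contraNneq ge => /= ->; apply/mapP; exists (h, l).
Qed.

(** The data of regular matrices: each partition has a single part, recorded as
    the exponent of its polynomial. *)
Definition single_part_data e : seq ({poly F} * seq nat) :=
  [seq (gk.1, [:: gk.2]) | gk <- e].

Lemma single_part_dataP (d : seq ({poly F} * seq nat)) :
  {in d, forall fl, size fl.2 = 1%N} -> exists e, d = single_part_data e.
Proof.
elim: d => [_|[g l] d IHd dl]; first by exists [::].
have [|e ->] := IHd; first by move=> fl fld; apply: dl; rewrite in_cons fld orbT.
have /= := dl _ (mem_head _ _); case: l {dl} => [|k [|]] // _.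
by exists ((g, k) :: e).
Qed.

Lemma elementary_divisors_single e :
  [seq fl.1 ^+ k | fl <- single_part_data e, k <- fl.2] =
  [seq gk.1 ^+ gk.2 | gk <- e].
Proof. by elim: e => //= -[g k] e /= ->. Qed.

Lemma comb_data_cyclic A e (f := \prod_(gk <- e) gk.1 ^+ gk.2) :
  is_comb_data A (single_part_data e) ->
  [/\ f \is monic, deg f = n, cyclic_mx A f
    & {in e, forall gk, irred gk.1 /\ (0 < gk.2)%N}].
Proof.
case=> ue de se; rewrite elementary_divisors_single => iso_e.
have ie : {in e, forall gk, irred gk.1 /\ (0 < gk.2)%N}.
  move=> gk gke; have [|[mg ig _] [/andP[_ k0] _]] := de (gk.1, [:: gk.2]).
    by apply/mapP; exists gk.
  by split; [apply/irredP | move: k0; rewrite inE eq_sym lt0n].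
have fs : f = \prod_(r <- [seq gk.1 ^+ gk.2 | gk <- e]) r by rewrite big_map.
have sm : {in [seq gk.1 ^+ gk.2 | gk <- e], forall r, r \is monic /\ (1 < size r)%N}.
  by move=> r /mapP[gk /ie[ig k0] ->]; apply: irred_exp_monic.
have sm' : {in [seq gk.1 ^+ gk.2 | gk <- e], forall r, r \is monic}.
  by move=> r /sm[].
split=> //.
- by rewrite fs big_seq; apply: monic_prod.
- rewrite fs sum_deg_prod // big_map -se big_map; apply: eq_bigr => gk _ /=.
  by rewrite addn0 /deg size_exp mulnC.
apply: module_iso_cyclic iso_e => // p; rewrite all_map.
apply: dvdp_prod_irred_exp => [|gk /ie[]//].
by move: ue; rewrite /single_part_data -map_comp.
Qed.

Lemma cyclic_comb_data A f : f \is monic -> deg f = n -> ~~ ('X %| f) ->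
  cyclic_mx A f ->
  is_comb_data A (single_part_data
    [seq (g, mult g f) | g <- irreds F n & (0 < mult g f)%N]).
Proof.
move=> mf df Xf fA; have f0 := monic_neq0 mf; set e := [seq _ | _ <- _ & _].
have ie : {in e, forall gk, [/\ irred gk.1, gk.1 != 'X & (0 < gk.2)%N]}.
  move=> gk /mapP[g]; rewrite mem_filter mem_irreds => /and3P[k0 ig _] -> /=.
  by split=> //; apply: contraNneq Xf => <-; rewrite -mult_gt0.
have ue : uniq [seq gk.1 | gk <- e].
  by rewrite -map_comp map_id; apply/filter_uniq/uniq_irreds.
have fe : f = \prod_(gk <- e) gk.1 ^+ gk.2.
  rewrite big_map big_filter big_mkcond {1}(@monic_factorization _ f n) ?df //.
  by apply: eq_bigr => g _ /=; case: posnP => // ->.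
split.
- by rewrite /single_part_data -map_comp.
- move=> _ /mapP[gk /ie[/irredP[ig mg] gX k0] ->]; split=> //; split=> //.
  by rewrite /is_partition /= inE eq_sym -lt0n.
- rewrite big_map big_map big_filter big_mkcond -df [RHS](@deg_sum_mult _ f n) ?df //.
  by apply: eq_bigr => g _ /=; rewrite addn0; case: posnP => // ->.
rewrite elementary_divisors_single; apply: cyclic_module_iso.
- by move=> r /mapP[gk /ie[ig _ k0] ->]; apply: irred_exp_monic.
- move=> p; rewrite big_map all_map; apply: dvdp_prod_irred_exp => // gk /ie[]//.
- by rewrite big_map -fe.
by rewrite big_map -fe.
Qed.

Lemma squarefree_prod_irred (s : seq {poly F}) : uniq s -> {in s, forall g, irred g} ->
  squarefree (\prod_(g <- s) g).
Proof.
elim: s => [|g s IHs] /=.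
  move=> _ _; rewrite big_nil; apply/squarefreeP; rewrite ?oner_neq0 // => g _.
  by rewrite mult1.
case/andP=> gs us ie; have ig := ie g (mem_head _ _).
have is' : {in s, forall g, irred g} by move=> h hs; apply: ie; rewrite in_cons hs orbT.
rewrite big_cons squarefree_irredM ?IHs //=; last first.
  by rewrite big_seq; apply/monic_neq0/monic_prod => h /is'/irred_monic.
rewrite -irred_coprime // big_seq.
apply: (big_rec (fun x => coprimep g x) (coprimep1 _)) => h a hs ga.
rewrite coprimepMr ga andbT irred_coprime // irred_dvd ?(is' h hs) //.
by apply: contraNneq gs => ->.
Qed.

Lemma regularP A : A \in unitmx ->
  regular A <-> exists f, [/\ f \is monic, deg f = n & cyclic_mx A f].
Proof.
move=> uA; split=> [[d dA /single_part_dataP[e de]]|[f [mf df fA]]].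
  rewrite de in dA; have [mf df fA _] := comb_data_cyclic dA.
  by exists (\prod_(gk <- e) gk.1 ^+ gk.2).
have Xf : ~~ ('X %| f) by rewrite -(cyclic_mx_unit mf df fA).
apply: ex_intro2 (cyclic_comb_data mf df Xf fA) _.
by move=> _ /mapP[gk _ ->].
Qed.

Lemma regular_semisimpleP A : A \in unitmx ->
  regular_semisimple A <->
  exists f, [/\ f \is monic, deg f = n, squarefree f & cyclic_mx A f].
Proof.
move=> uA; split=> [[d dA d1]|[f [mf df sf fA]]].
  have [|e de] := @single_part_dataP d; first by move=> fl /d1 ->.
  rewrite de in dA d1; have [mf df fA ie] := comb_data_cyclic dA.
  exists (\prod_(gk <- e) gk.1 ^+ gk.2); split=> //.
  have -> : \prod_(gk <- e) gk.1 ^+ gk.2 = \prod_(g <- [seq gk.1 | gk <- e]) g.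
    rewrite big_map big_seq [RHS]big_seq; apply: eq_bigr => gk gke.
    have [->] : [:: gk.2] = [:: 1%N]; last by rewrite expr1.
    by apply: (d1 (gk.1, [:: gk.2])); apply/mapP; exists gk.
  apply: squarefree_prod_irred.
    by case: dA => + _ _ _; rewrite /single_part_data -map_comp.
  by move=> g /mapP[gk /ie[ig _] ->].
have Xf : ~~ ('X %| f) by rewrite -(cyclic_mx_unit mf df fA).
apply: ex_intro2 (cyclic_comb_data mf df Xf fA) _.
move=> _ /mapP[_ /mapP[g + ->] ->] /=; rewrite mem_filter mem_irreds => /and3P[k0 ig _].
congr [:: _]; apply/eqP; rewrite eqn_leq k0 andbT.
by have /squarefreeP := sf; apply; rewrite // monic_neq0.
Qed.

End CombinatorialDataOfCyclic.

(** * Counting conjugacy classes *)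

Section CountingClasses.
Variables (F : finFieldType) (M n' : nat).
Local Notation n := n'.+1.
Hypotheses (M_pr : prime M) (coMq : coprime M #|F|).
Local Notation gT := {'GL_n[F]}.

Lemma GL_conjE (x y : gT) :
  GLval (x ^ y)%g = invmx (GLval y) *m GLval x *m invmx (invmx (GLval y)).
Proof. by rewrite invmxK /conjg !GL_MxE GL_VxE mulmxA. Qed.

Lemma GL_val_exp (x : gT) k : GLval (x ^+ k)%g = GLval x ^+ k.
Proof.
elim: k => [|k IHk]; first by rewrite expg0 expr0.
by rewrite expgS exprS GL_ME IHk.
Qed.

Lemma GL_val_inj (x y : gT) : GLval x = GLval y -> x = y.
Proof. exact: val_inj. Qed.

Lemma GL_lift (A : 'M[F]_n) : A \in unitmx -> exists x : gT, GLval x = A.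
Proof. by move=> uA; exists (FinRing.unit _ uA). Qed.

Lemma power_imageP (x : gT) : (0 < M)%N ->
  reflect (exists B, B ^+ M = GLval x) (x \in power_image F n M).
Proof.
move=> M0; apply: (iffP imsetP) => [[y _ ->]|[B BM]].
  by exists (GLval y); rewrite GL_val_exp.
have uB : B \in unitmx.
  have := GL_unitmx x; rewrite -[\val x]BM => uBM.
  by rewrite -[_ \in _]/(B \is a GRing.unit) -(unitrX_pos _ M0).
have [y yB] := GL_lift uB; exists y; first by rewrite inE.
by apply: GL_val_inj; rewrite -[LHS]BM -yB -GL_val_exp.
Qed.

Definition cyclic_class (f : {poly F}) : {set gT} :=
  [set x | `[< cyclic_mx (GLval x) f >]].

Lemma class_cyclicE f (x : gT) : f \is monic -> deg f = n ->
  cyclic_mx (GLval x) f -> (x ^: 'GL_n[F])%g = cyclic_class f.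
Proof.
move=> mf df fx; apply/setP => y; rewrite inE; apply/imsetP/asboolP.
  case=> z _ ->; rewrite GL_conjE; apply: cyclic_mx_conj fx => //.
  by rewrite unitmx_inv GL_unitmx.
move=> fy; have [T uT yT] := cyclic_mx_similar mf df fx fy.
have [z zT] : exists z : gT, GLval z = invmx T by apply: GL_lift; rewrite unitmx_inv.
by exists z; rewrite ?inE //; apply: GL_val_inj; rewrite GL_conjE zT !invmxK.
Qed.

Lemma cyclic_class_nonempty f : f \is monic -> deg f = n -> ~~ ('X %| f) ->
  exists x : gT, cyclic_mx (GLval x) f.
Proof.
move=> mf df Xf; have fC := cyclic_mulX_mx mf df.
have [x xE] : exists x : gT, GLval x = (mulX_mx n' f)^T.
  by apply: GL_lift; rewrite (cyclic_mx_unit mf df fC).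
by exists x; rewrite xE.
Qed.

(** A class of cyclic matrices is determined by its annihilator [f], and it
    consists of [M]-th powers exactly when [X] is an [M]-th power modulo [f]. *)
Lemma card_cyclic_classes (R : 'M[F]_n -> Prop) (P : pred {poly F}) :
    (forall A, A \in unitmx -> R A <->
      exists f, [/\ f \is monic, deg f = n, P f & cyclic_mx A f]) ->
  #|[set C in classes 'GL_n[F] | [exists A in C, `[< R (GLval A) >]]
                                 && (C \subset power_image F n M)]|
  = count (fun f => factors_in (good M) f && P f) (monics F n).
Proof.
move=> RP; have M0 := prime_gt0 M_pr.
set L := [seq f <- monics F n | factors_in (good M) f && P f].
rewrite -size_filter -/L -(size_map cyclic_class) cardE.
apply/perm_size/uniq_perm; first exact: enum_uniq.
  rewrite map_inj_in_uniq; first exact/filter_uniq/uniq_monics.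
  move=> f g; rewrite [f \in _]mem_filter [g \in _]mem_filter !mem_monics.
  move=> /andP[/andP[Gf _] /andP[mf /eqP df]] /andP[_ /andP[mg /eqP dg]] fg.
  have [Xf _] := (factors_in_goodP coMq mf).1 Gf.
  have [x fx] := cyclic_class_nonempty mf df Xf.
  have : x \in cyclic_class f by rewrite inE; apply/asboolP.
  by rewrite fg inE => /asboolP; apply: cyclic_mx_inj fx.
move=> C; rewrite mem_enum inE; apply/and3P/mapP.
  case=> /imsetP[x _ ->] /existsP[y /andP[yx /asboolP Ry]] sub.
  have [f [mf df Pf fy]] := (RP _ (GL_unitmx y)).1 Ry.
  exists f; last by rewrite -(class_cyclicE mf df fy); apply/esym/class_eqP.
  rewrite mem_filter Pf andbT mem_monics mf df eqxx !andbT.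
  apply/(factors_in_goodP coMq mf).2; split.
    by rewrite -(cyclic_mx_unit mf df fy); apply: (GL_unitmx y).
  apply/(cyclic_mx_powerP mf df M0 fy).1/(power_imageP _ M0).
  exact: (subsetP sub).
case=> f; rewrite mem_filter mem_monics => /andP[/andP[Gf Pf] /andP[mf /eqP df]] ->.
have [Xf pf] := (factors_in_goodP coMq mf).1 Gf.
have [x fx] := cyclic_class_nonempty mf df Xf.
split.
- by rewrite -(class_cyclicE mf df fx) mem_classes ?inE.
- apply/existsP; exists x; rewrite inE; apply/andP; split; apply/asboolP => //.
  by apply/(RP _ (GL_unitmx x)).2; exists f.
apply/subsetP => y; rewrite inE => /asboolP fy.
exact/(power_imageP _ M0)/(cyclic_mx_powerP mf df M0 fy).2.
Qed.

Lemma c_rgE : c_rg F n M = count (factors_in (good M)) (monics F n).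
Proof.
rewrite /c_rg (@card_cyclic_classes (@regular F n) predT) => [|A uA].
  by apply: eq_count => f; rewrite andbT.
apply: iff_trans (regularP uA) _.
by split=> [[f [mf df fA]]|[f [mf df _ fA]]]; exists f.
Qed.

Lemma c_rsE : c_rs F n M =
  count (fun f => factors_in (good M) f && squarefree f) (monics F n).
Proof. by apply: card_cyclic_classes => A; apply: regular_semisimpleP. Qed.

End CountingClasses.

(** * The generating functions *)

Lemma dvdn_order_mod M q (M_gt1 : (1 < M)%N) (coMq : coprime M q) e :
  (0 < q)%N -> (M %| q ^ e - 1)%N = (order_mod M_gt1 coMq %| e)%N.
Proof.
move=> q0; rewrite /order_mod order_dvdn -eqn_mod_dvd ?expn_gt0 ?q0 //.
rewrite -val_eqE FinRing.val_unitX /= -natrX -val_eqE /= -[1%R]/(1%:R).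
by rewrite val_Zp_nat // Zp_cast.
Qed.

Lemma monics0 (F : finFieldType) (P : pred {poly F}) : P 1 ->
  count P (monics F 0) = 1%N.
Proof.
move=> P1; have /seq.permP -> : perm_eq (monics F 0) [:: 1]; last by rewrite /= P1.
apply: uniq_perm; rewrite ?uniq_monics // => f; rewrite mem_monics inE.
apply/andP/eqP => [[mf /eqP]|->]; first exact: monic_deg0.
by rewrite monic1 /deg size_poly1.
Qed.

Lemma factors_in1 (F : finFieldType) (G : pred {poly F}) : factors_in G 1.
Proof.
apply/factors_inP => [|g ig]; first exact: oner_neq0.
by move/(leq_deg (oner_neq0 _)); rewrite {2}/deg size_poly1 leqNgt irred_deg_gt0.
Qed.

Lemma squarefree1 (F : finFieldType) : squarefree (1 : {poly F}).
Proof. by apply/squarefreeP => [|g _]; rewrite ?oner_neq0 ?mult1. Qed.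

(** Reads a recurrence on counting numbers as a logarithmic derivative. *)
Lemma logder_count (a : nat -> nat) (s : nat -> rat) (l : fps rat) (A : fps rat) :
    fpscoef l 0 = 0 -> (forall m, (0 < m)%N -> fpscoef l m = s m) ->
    (forall n, fpscoef A n = (a n)%:R) ->
    (forall n, n%:R * (a n)%:R = \sum_(1 <= m < n.+1) (a (n - m)%N)%:R * s m) ->
  logder A l.
Proof.
move=> l0 ls Aa rec; apply/fpsP => n; rewrite fpscoef_theta Aa rec mulrC fpscoefM.
rewrite big_add1 /= big_mkord big_ord_recl /= l0 mul0r add0r.
by apply: eq_bigr => i _; rewrite Aa ls // mulrC.
Qed.

Section Main.
Variables (F : finFieldType) (M t : nat).
Hypotheses (M_pr : prime M) (t_gt0 : (0 < t)%N).
Local Notation q := #|F|.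
Hypothesis M_dvd : forall e, (M %| q ^ e - 1)%N = (t %| e)%N.

(** The logarithmic derivative that [product_formula] asks for. *)
Let target (lser : nat -> fps rat) : fps rat :=
  FPS (fun n => fpscoef (lser q) n + \sum_(k < n.+1)
      (1 - M%:R) / M%:R * fpscoef (fps_subst (M ^ k * t) (lser (q ^ t)%N)) n).

Let coef_target lser m : fpscoef (target lser) m = fpscoef (lser q) m +
  \sum_(k < m.+1) (1 - M%:R) / M%:R *
    fpscoef (fps_subst (M ^ k * t) (lser (q ^ t)%N)) m.
Proof. by []. Qed.

Let q_gt0 : (0 < q)%N. Proof. exact: ltnW (card_finNzRing_gt1 F). Qed.

Lemma coef_target0 lser : (forall r, fpscoef (lser r) 0 = 0) ->
  fpscoef (target lser) 0 = 0.
Proof.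
move=> l0; rewrite coef_target big_ord1 fpscoef_subst dvdn0 div0n !l0.
by rewrite mulr0 addr0.
Qed.

Lemma coef_c_log r n : (0 < r)%N -> (0 < n)%N -> fpscoef (c_log r) n = (r ^ n - 1)%:R.
Proof.
by move=> r0; case: n => // n _; rewrite natrB ?expn_gt0 ?r0 // natrX.
Qed.

Lemma coef_target_c m : (0 < m)%N ->
  fpscoef (target c_log) m = factor_sum (good M : pred {poly F}) 1 m.
Proof.
move=> m0; rewrite (factor_sum_goodE M_pr t_gt0 M_dvd m0) coef_target.
rewrite -(coef_c_log q_gt0 m0); congr (_ + _).
apply: eq_bigr => i _; move: (nat_of_ord i) => k.
rewrite fpscoef_subst; case: ifP => // /[dup] kt /dvdnP[j mE]; congr (_ * _).
have Mk0 : (0 < M ^ k)%N by rewrite expn_gt0 prime_gt0.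
have j0 : (0 < j)%N by case: j mE m0 => // ->.
rewrite mE mulnK ?muln_gt0 ?Mk0 // coef_c_log ?expn_gt0 ?q_gt0 //.
by rewrite -expnM mulnCA mulKn // [(t * j)%N]mulnC.
Qed.

Lemma fps_subst_comp a b (f : fps rat) :
  fps_subst a (fps_subst b f) = fps_subst (a * b) f.
Proof.
apply/fpsP => n; rewrite !fpscoef_subst divnMA.
case: (boolP (a %| n)%N) => an; first by rewrite dvdn_divRL // mulnC.
by rewrite ifN //; apply: contra an; apply/dvdn_trans/dvdn_mulr.
Qed.

Lemma fps_subst_mod_square k (l : fps rat) :
  fps_subst k (mod_square l) = mod_square (fps_subst k l).
Proof.
rewrite /mod_square fps_subst_comp mulnC -fps_subst_comp !natr_fps.
apply/fpsP => n; rewrite fpscoef_subst !fpscoefD !fpscoefN !fpscoefCM !fpscoef_subst.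
by case: ifP => //; rewrite mulr0 subr0.
Qed.

Lemma coef_target_s m : (0 < m)%N ->
  fpscoef (target (fun r => mod_square (c_log r))) m =
    factor_sum (good M : pred {poly F}) (-1) m.
Proof.
move=> m0; rewrite factor_sum_squarefree -(coef_target_c m0).
have -> : fpscoef (target (fun r => mod_square (c_log r))) m =
    fpscoef (target c_log) m - (if (2 %| m)%N then 2%:R * (fpscoef (c_log q) (m %/ 2)
      + \sum_(k < m.+1) (1 - M%:R) / M%:R *
           fpscoef (fps_subst (M ^ k * t) (c_log (q ^ t)%N)) (m %/ 2)) else 0).
  rewrite !coef_target.
  under eq_bigr => k _ do rewrite fps_subst_mod_square coef_mod_square mulrBr.
  rewrite sumrB coef_mod_square; case: ifP => _; last first.
    by rewrite !subr0 [X in _ - X]big1 ?subr0 // => k _; rewrite mulr0.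
  rewrite mulrDr mulr_sumr; under [X in _ - (_ + X)]eq_bigr => k _ do rewrite mulrCA.
  ring.
case: ifP => // m2; have m20 : (0 < m %/ 2)%N by rewrite divn_gt0 // dvdn_leq.
rewrite -(coef_target_c m20) coef_target.
congr (_ - 2%:R * (_ + _)); have m2m : ((m %/ 2).+1 <= m.+1)%N by rewrite ltnS leq_div.
rewrite [RHS](big_ord_widen m.+1 (fun k => (1 - M%:R) / M%:R *
   fpscoef (fps_subst (M ^ k * t) (c_log (q ^ t)%N)) (m %/ 2)) m2m).
rewrite [RHS]big_mkcond; apply: eq_bigr => k _; case: ltnP => // mk.
rewrite fpscoef_subst ifF ?mulr0 //; apply/negP => /(dvdn_leq m20).
rewrite leqNgt => /negP[]; rewrite (leq_trans mk) //.
by rewrite (leq_trans (ltnW (ltn_expl k (prime_gt1 M_pr)))) // leq_pmulr.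
Qed.

End Main.

Theorem theorem8p3 (M q : nat) (F : finFieldType) (M_prime : prime M)
    (cardF : #|F| = q) (coMq : coprime M q) (t : nat)
    (t_def : t = order_mod (prime_gt1 M_prime) coMq) :
  (exists2 P : fps rat,
     is_fps_prod (fun k => fps_ratpow (fps_subst (M ^ k * t) (c_ser (q ^ t)))
                             ((1 - M%:R) / (M ^ k.+1 * t)%:R)) P
   & FPS (fun n => if n == 0%N then 1 else (c_rg F n M)%:R) = c_ser q * P)
  /\
  (exists2 P : fps rat,
     is_fps_prod (fun k => fps_ratpow (fps_subst (M ^ k * t) (s_ser (q ^ t)))
                             ((1 - M%:R) / (M ^ k.+1 * t)%:R)) P
   & FPS (fun n => if n == 0%N then 1 else (c_rs F n M)%:R) = s_ser q * P).
Proof.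
have t_gt0 : (0 < t)%N by rewrite t_def order_gt0.
have q_gt0 : (0 < q)%N by rewrite -cardF ltnW ?card_finNzRing_gt1.
have M_dvd e : (M %| q ^ e - 1)%N = (t %| e)%N by rewrite t_def; apply: dvdn_order_mod.
move=> {t_def}; subst q; split.
- apply: (product_formula (lser := c_log)) => //;
    [exact: prime_gt1|exact: c_ser0|exact: logder_c|].
  apply: (logder_count (a := fun n => count (factors_in (good M)) (monics F n))
    (s := factor_sum (good M : pred {poly F}) 1)).
  + exact: coef_target0.
  + by move=> m m0; rewrite -(coef_target_c M_prime t_gt0 M_dvd m0).
  + by case=> [|n] /=; rewrite ?c_rgE // monics0 ?factors_in1.
  exact: count_factors_in_logder.
apply: (product_formula (lser := fun r => mod_square (c_log r))) => //;
  [exact: prime_gt1|exact: s_ser0| |exact: logder_s|].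
  by move=> r; rewrite coef_mod_square /= mulr0 subr0.
apply: (logder_count
    (a := fun n => count (fun f => factors_in (good M) f && squarefree f) (monics F n))
    (s := factor_sum (good M : pred {poly F}) (-1))).
- apply: (@coef_target0 F M t (fun r => mod_square (c_log r))) => r.
  by rewrite coef_mod_square /= mulr0 subr0.
- by move=> m m0; rewrite -(coef_target_s M_prime t_gt0 M_dvd m0).
- by case=> [|n] /=; rewrite ?c_rsE // monics0 ?factors_in1 ?squarefree1.
exact: count_squarefree_logder.
Qed.
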